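(* Let $D$ be a simple $\mathbb{C}$-derivation of $\mathbb{C}[x,y]$ and let $\rho\in \mathrm{Aut}(\mathbb{C}[x,y])_D$. Then the dynamical degree of $\rho$ satisfies $\delta(\rho)=1$.
   Context: A $\mathbb{C}$-derivation of $\mathbb{C}[x,y]$ is a $\mathbb{C}$-linear map $d$ of $\mathbb{C}[x,y]$ to itself with $d(fg)=d(f)g+f\,d(g)$ for all $f,g$. A derivation $d$ is called simple if the only ideals $I$ of $\mathbb{C}[x,y]$ with $d(I)\subset I$ are $0$ and $\mathbb{C}[x,y]$. $\mathrm{Aut}(\mathbb{C}[x,y])$ is the group of $\mathbb{C}$-algebra automorphisms of $\mathbb{C}[x,y]$, and the isotropy group of $D$ is $\mathrm{Aut}(\mathbb{C}[x,y])_D=\{\rho\in\mathrm{Aut}(\mathbb{C}[x,y]) : \rho\circ D=D\circ\rho\}$. For a polynomial map $f=(f_1,f_2):\mathbb{C}^2\to\mathbb{C}^2$, put $\deg(f)=\max(\deg(f_1),\deg(f_2))$; the dynamical degree of $f$ is $\delta(f)=\lim_{n\to\infty}(\deg(f^n))^{1/n}$, where $f^n$ is the $n$-th iterate of $f$. An automorphism $\rho$ of $\mathbb{C}[x,y]$ is identified with the polynomial map $(\rho(x),\rho(y)):\mathbb{C}^2\to\mathbb{C}^2$, and $\delta(\rho)$ denotes the dynamical degree of this map. *)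

(* Defs.v *)
From HB Require Import structures.
From mathcomp Require Import all_boot all_order all_algebra.
(* mpoly has to be imported before MathComp-Analysis: the other order makes
   their notations clash. *)
From mathcomp Require Import mpoly.
From mathcomp Require Import complex.
From mathcomp Require Import boolp classical_sets reals topology normedtype.
From mathcomp Require Import sequences exp.

Set Implicit Arguments.
Unset Strict Implicit.
Unset Printing Implicit Defensive.

Import Order.TTheory GRing.Theory Num.Theory.
Import numFieldNormedType.Exports.

Local Open Scope classical_set_scope.
Local Open Scope ring_scope.

(* The library's [idealr_closed] only describes boolean proper ideals; here
   the zero ideal and the whole ring must both be allowed. *)
Definition is_ideal (A : comNzRingType) (I : set A) : Prop :=
  [/\ I 0,
      forall f g, I f -> I g -> I (f + g)
    & forall h f, I f -> I (h * f)].

Definition is_derivation (K : comNzRingType) (A : comAlgType K)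
    (d : {linear A -> A}) : Prop :=
  forall f g : A, d (f * g) = d f * g + f * d g.

Definition simple_derivation (K : comNzRingType) (A : comAlgType K)
    (d : {linear A -> A}) : Prop :=
  is_derivation d /\
  forall I : set A, is_ideal I -> d @` I `<=` I -> I = [set 0] \/ I = setT.

Definition isotropy_group (K : comNzRingType) (A : comAlgType K)
    (d : {linear A -> A}) : set {lrmorphism A -> A} :=
  [set rho : {lrmorphism A -> A} | bijective rho /\ rho \o d = d \o rho].

(* Polynomial maps are represented formally, by their two coordinate
   polynomials; over an infinite field this is the same as the induced
   self-map of the plane. *)
Definition polymap (K : comNzRingType) := 2.-tuple {mpoly K[2]}.

Definition polymap_id (K : comNzRingType) : polymap K :=
  [tuple 'X_i | i < 2].

Definition polymap_comp (K : comNzRingType) (f g : polymap K) : polymap K :=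
  [tuple tnth f i \mPo g | i < 2].

Definition polymap_iter (K : comNzRingType) (n : nat) (f : polymap K) :
    polymap K :=
  iter n (polymap_comp f) (polymap_id K).

(* [msize] is the total degree plus one, and [msize 0 = 0]; the zero
   polynomial is thus given degree 0. *)
Definition total_degree (K : comNzRingType) (p : {mpoly K[2]}) : nat :=
  (msize p).-1.

Definition polymap_degree (K : comNzRingType) (f : polymap K) : nat :=
  maxn (total_degree (tnth f ord0)) (total_degree (tnth f ord_max)).

Definition dynamical_degree_seq (R : realType) (f : polymap R[i]) : R^nat :=
  fun n => (polymap_degree (polymap_iter n f))%:R `^ (n%:R)^-1.

Definition dynamical_degree (R : realType) (f : polymap R[i]) : R :=
  limn (dynamical_degree_seq f).

Definition polymap_of (K : comNzRingType)
    (rho : {lrmorphism {mpoly K[2]} -> {mpoly K[2]}}) : polymap K :=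
  [tuple rho 'X_i | i < 2].

(* Main.v *)
Require Import Defs.
From HB Require Import structures.
From mathcomp Require Import all_boot all_order all_algebra.
From mathcomp Require Import mpoly.
From mathcomp Require Import complex.
From mathcomp Require Import boolp classical_sets reals topology normedtype.
From mathcomp Require Import sequences exp.
From mathcomp Require Import ring zify.

Set Implicit Arguments.
Unset Strict Implicit.
Unset Printing Implicit Defensive.

Import Order.TTheory GRing.Theory Num.Theory.
Import numFieldNormedType.Exports.

Local Open Scope classical_set_scope.
Local Open Scope ring_scope.

(* Let [f] be an automorphism commuting with the simple derivation [D].  By
   Jung's theorem [f] is conjugate either to a triangular or affine map, whose
   iterates have bounded degree, or to a composition of Henon maps
   [swap t1 .. swap tn] with every triangular [ti] of degree at least 2.  The
   second case is impossible.  There the degrees of the iterates tend to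
   infinity both forwards and backwards, while [D] raises degrees by a bounded
   amount; since [f^n (D^j x) = D^j (f^n x)], the element [D^j x] has bounded
   growth under [f] and [f^-1] relative to [x], and the Shestakov-Umirbaev
   inequality turns this into a bound on its degree independent of [j].  So [D]
   is locally finite.  Eigenvectors of a simple derivation are constants, hence
   [D] is locally nilpotent with constant kernel; then it has a slice [s] and
   both coordinates are polynomials in [s], which contradicts their algebraic
   independence.  The same inequality gives Jung's theorem. *)

(** * Polynomial substitutions and the Jacobian *)

(** The obstacle is cancellation: the leading forms of [f x] and [f y] may be algebraically
    dependent, so the degree of [f G] can lie far below the weighted degree of [G]. The loss is
    limited because the Jacobian of [f x] and [f y] is a nonzero constant: bracketing with [f x] is,
    up to that constant, the derivative in [y] carried through [f], and brackets have bounded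
    degree. A word bounds the [y]-degree of [D^j x] only by 3/4 of its [x]-degree plus a constant.
    The inverse word, conjugated by [swap], exchanges the variables, and as 3/4 < 1 the two
    inequalities bound both degrees. The bound is uniform in [j] because the power of the word is
    chosen after [j]. *)

Lemma ord2P (i : 'I_2) : i = ord0 \/ i = ord_max.
Proof. by case: i => [[|[|//]] p]; [left|right]; apply: val_inj. Qed.

Lemma mpoly_ring_ind (n : nat) (R : comNzRingType) (P : {mpoly R[n]} -> Prop) :
  (forall c, P c%:MP) -> (forall i, P 'X_i) ->
  (forall u v, P u -> P v -> P (u + v)) ->
  (forall u v, P u -> P v -> P (u * v)) -> forall h, P h.
Proof.
move=> PC PX PD PM h; elim/mpolyind: h => [|c m h _ _ Ph].
  by rewrite -(mpolyC0 n R).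
apply/PD => //; rewrite -mul_mpolyC; apply/PM => //.
rewrite mpolyXE_id; elim/big_rec: _ => [|i u _ Pu]; first by rewrite -(mpolyC1 n R).
apply/PM => //; elim: (m i) => [|k IH]; first by rewrite expr0 -(mpolyC1 n R).
by rewrite exprS; apply/PM.
Qed.

Section Substitution.
Variable K : numFieldType.
Local Notation A := {mpoly K[2]}.
Local Notation x := ('X_ord0 : A).
Local Notation y := ('X_ord_max : A).

Lemma rmorph_ext (B : comNzRingType) (f g : {rmorphism A -> B}) :
  (forall c, f c%:MP = g c%:MP) -> f x = g x -> f y = g y -> f =1 g.
Proof.
move=> fgC fgx fgy; apply: mpoly_ring_ind => // [i|u v eu ev|u v eu ev].
- by case: (ord2P i) => ->.
- by rewrite !rmorphD eu ev.
- by rewrite !rmorphM eu ev.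
Qed.

Lemma lrmorphC (f : {lrmorphism A -> A}) c : f c%:MP = c%:MP.
Proof.
have -> : c%:MP = c *: 1 :> A by rewrite -mul_mpolyC mulr1.
by rewrite linearZ rmorph1.
Qed.

Lemma lrmorph_ext (f g : {lrmorphism A -> A}) : f x = g x -> f y = g y -> f =1 g.
Proof.
by move=> fx fy; apply: rmorph_ext => // c; exact: etrans (lrmorphC f c) (esym (lrmorphC g c)).
Qed.

(** Stated for a derivation along [f] with values in another ring, so that it covers [jacobian u]
    composed with [f], both derivatives of the chart, and [D] itself. *)
Lemma derivation_chain (B : comNzRingType) (f : {rmorphism A -> B}) (E : A -> B) :
  (forall c, E c%:MP = 0) -> {morph E : u v / u + v} ->
  (forall u v, E (u * v) = E u * f v + f u * E v) ->
  forall h, E h = f h^`M(ord0) * E x + f h^`M(ord_max) * E y.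
Proof.
move=> EC ED EM; apply: mpoly_ring_ind => [c|i|u v eu ev|u v eu ev].
- by rewrite EC !mderivC rmorph0 !mul0r addr0.
- rewrite !mderivX !mnm1E.
  have s0 (j : 'I_2) : (U_(j) - U_(j) = 0)%MM by apply/mnmP => k; rewrite mnmBE mnm0E subnn.
  by case: (ord2P i) => ->; rewrite s0 mpolyX0 scale1r scale0r rmorph0 rmorph1 mul0r mul1r
    ?addr0 ?add0r.
- by rewrite ED eu ev !mderivD !rmorphD /=; ring.
- by rewrite EM eu ev !mderivM !rmorphD !rmorphM /=; ring.
Qed.

Definition jacobian (u v : A) : A :=
  u^`M(ord0) * v^`M(ord_max) - u^`M(ord_max) * v^`M(ord0).

Lemma jacobianC u v : jacobian u v = - jacobian v u.
Proof. by rewrite /jacobian opprB [u^`M(_) * _]mulrC [_ * v^`M(ord0)]mulrC. Qed.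

Lemma jacobianDr u : {morph jacobian u : v w / v + w}.
Proof. by move=> v w; rewrite /jacobian !mderivD !mulrDr opprD addrACA. Qed.

Lemma jacobianMr u v w : jacobian u (v * w) = jacobian u v * w + v * jacobian u w.
Proof.
have E (R : comNzRingType) (a b v' w' v1 v2 w1 w2 : R) :
    a * (v2 * w' + v' * w2) - b * (v1 * w' + v' * w1)
    = (a * v2 - b * v1) * w' + v' * (a * w2 - b * w1) by ring.
by rewrite /jacobian !mderivM E.
Qed.

Lemma jacobianCr u c : jacobian u c%:MP = 0.
Proof. by rewrite /jacobian !mderivC !mulr0 subr0. Qed.

Lemma mderivXX (i j : 'I_2) : ('X_i : A)^`M(j) = (i == j)%:R.
Proof.
rewrite mderivX mnm1E; case: eqP => [->|_]; last by rewrite scale0r.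
have ->: (U_(j) - U_(j) = 0)%MM by apply/mnmP => k; rewrite mnmBE mnm0E subnn.
by rewrite mpolyX0 scale1r.
Qed.

Lemma jacobianXX : jacobian x y = 1.
Proof. by rewrite /jacobian !mderivXX /= mulr1 mul0r subr0. Qed.

Lemma jacobian_comp_r (f : {lrmorphism A -> A}) u h :
  jacobian u (f h) = f h^`M(ord0) * jacobian u (f x) + f h^`M(ord_max) * jacobian u (f y).
Proof.
apply: (derivation_chain (f := f) (E := fun h => jacobian u (f h))) => [c|v w|v w].
- by rewrite lrmorphC jacobianCr.
- by rewrite rmorphD jacobianDr.
- by rewrite rmorphM jacobianMr.
Qed.

Lemma jacobianvv u : jacobian u u = 0.
Proof. by rewrite /jacobian mulrC subrr. Qed.

Lemma jacobian_comp (f : {lrmorphism A -> A}) u v :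
  jacobian (f u) (f v) = f (jacobian u v) * jacobian (f x) (f y).
Proof.
have E (R : comNzRingType) (a b c d j : R) :
    c * - (a * 0 + b * j) + d * - (a * - j + b * 0) = (a * d - b * c) * j by ring.
rewrite jacobian_comp_r ![jacobian (f u) _]jacobianC.
rewrite (jacobian_comp_r f (f x)) (jacobian_comp_r f (f y)) !jacobianvv.
by rewrite [jacobian (f y) (f x)]jacobianC E /jacobian rmorphB !rmorphM.
Qed.

Lemma mpoly_unitP (u v : A) : u * v = 1 -> exists2 c, c != 0 & u = c%:MP.
Proof.
move=> e; have := mpoly_intro_unit (etrans (mulrC v u) e).
rewrite unfold_in => /andP[/eqP uC cU]; exists u@_0 => //.
by apply: contraTneq cU => ->; rewrite unitr0.
Qed.

(** The chain rule for [f (g x) = x] and [f (g y) = y] makes the Jacobian a unit. *)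
Lemma jacobian_auto (f g : {lrmorphism A -> A}) : cancel g f ->
  exists2 c, c != 0 & jacobian (f x) (f y) = c%:MP.
Proof.
move=> fg; apply: (@mpoly_unitP _ (f (jacobian (g x) (g y)))).
by rewrite mulrC -jacobian_comp !fg jacobianXX.
Qed.

End Substitution.

(** * Leading forms *)

Lemma coefM_top (R : nzRingType) (U V : {poly R}) m n :
  (size U <= m.+1)%N -> (size V <= n.+1)%N -> (U * V)`_(m + n) = U`_m * V`_n.
Proof.
move=> sU sV; rewrite coefM.
have lem : (m < (m + n).+1)%N by rewrite ltnS leq_addr.
rewrite (bigD1 (Ordinal lem)) //= addKn big1 ?addr0 // => i /eqP ne.
have [lt|gt|eq] := ltngtP i m.
- by rewrite (nth_default 0 (leq_trans sV _)) ?mulr0 //; lia.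
- by rewrite (nth_default 0 (leq_trans sU _)) ?mul0r.
- by case: ne; apply: val_inj.
Qed.

Lemma map_poly_derivM (R : comNzRingType) (U V : {poly {poly R}}) :
  map_poly deriv (U * V) = map_poly deriv U * V + U * map_poly deriv V.
Proof.
apply/polyP => i; rewrite coefD !coefM coef_map coefM /= raddf_sum -big_split /=.
by apply: eq_bigr => j _; rewrite derivM !coef_map.
Qed.

(** Multiply by ['X] and compare coefficients at the sum of the degrees: both are the product of the
    leading coefficients, times the degree of [u] on the left and of [v] on the right. *)
Lemma size_eq_of_wronskian (K : numFieldType) (u v : {poly K}) :
  u != 0 -> v != 0 -> u^`() * v = u * v^`() -> size u = size v.
Proof.
have topE (p : {poly K}) : ('X * p^`())`_((size p).-1) = lead_coef p *+ (size p).-1.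
  rewrite coefXM coef_deriv lead_coefE.
  by case: ((size p).-1) => [|k] //=; rewrite mulr0n.
have topS (p : {poly K}) : (size ('X * p^`())%R <= (size p).-1.+1)%N.
  have [->|p0] := eqVneq p 0; first by rewrite deriv0 mulr0 size_poly0.
  rewrite prednK ?size_poly_gt0 //; apply: leq_trans (size_polyMleq _ _) _.
  by rewrite size_polyX /= lt_size_deriv.
move=> u0 v0 e.
have su : (0 < size u)%N by rewrite size_poly_gt0.
have sv : (0 < size v)%N by rewrite size_poly_gt0.
have := congr1 (fun p => ('X * p)`_((size u).-1 + (size v).-1)) e.
rewrite mulrA [in RHS]mulrCA !coefM_top ?topS ?prednK // !topE -!lead_coefE.
rewrite mulrnAl mulrnAr -[LHS]mulr_natr -[RHS]mulr_natr => /mulfI.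
rewrite mulf_neq0 ?lead_coef_eq0 // => /(_ isT) /eqP; rewrite eqr_nat => /eqP; lia.
Qed.

(** The derivative of [u / v] vanishes; without fractions: subtracting the multiple of [v] that
    cancels the leading term of [u] keeps the equation and lowers the degree. *)
Lemma wronskian_eq0 (K : numFieldType) (u v : {poly K}) :
  v != 0 -> u^`() * v = u * v^`() -> exists c, u = c *: v.
Proof.
move=> v0; elim: {u}_.+1 {-2}u (ltnSn (size u)) => // N IH u szu e.
have [->|u0] := eqVneq u 0; first by exists 0; rewrite scale0r.
have eqs := size_eq_of_wronskian u0 v0 e.
pose c := lead_coef u / lead_coef v.
have [||c' ec'] := IH (u - c *: v).
- apply: leq_trans (_ : (size u <= N)%N); last by rewrite -ltnS.
  have -> : size u = (size u).-1.+1 by rewrite prednK // size_poly_gt0.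
  rewrite ltnS; apply/leq_sizeP => i; rewrite leq_eqVlt => /predU1P[<-|lt].
    rewrite coefB coefZ -lead_coefE eqs -lead_coefE /c divfK ?subrr //.
    by rewrite lead_coef_eq0.
  have si : (size u <= i)%N by move: lt; case: (size u).
  by rewrite coefB coefZ (nth_default 0 si) (@nth_default _ 0 v) -?eqs // mulr0 subrr.
- by rewrite derivB derivZ !mulrBl e -!scalerAl [v^`() * v]mulrC.
by exists (c' + c); rewrite scalerDl -ec' subrK.
Qed.

Section LeadingForm.
Variable K : numFieldType.
Local Notation A := {mpoly K[2]}.
Local Notation x := ('X_ord0 : A).
Local Notation y := ('X_ord_max : A).

(* The chart [x = t], [y = s t]: the degree in [t] is the total degree, and the
   leading coefficient is the leading form, dehomogenised. *)
Definition chart : A -> {poly {poly K}} :=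
  mmap (polyC \o polyC) (fun i => if i == ord0 then 'X else 'X%:P * 'X).

HB.instance Definition _ := GRing.RMorphism.copy chart chart.

Lemma chartC c : chart c%:MP = c%:P%:P.
Proof. exact: mmapC. Qed.

Lemma chartx : chart x = 'X.
Proof. by rewrite /chart mmapX mmap1U. Qed.

Lemma charty : chart y = 'X%:P * 'X.
Proof. by rewrite /chart mmapX mmap1U. Qed.

Lemma chartX m : chart 'X_[m] = ('X^(m ord_max))%:P * 'X^(mdeg m).
Proof.
rewrite /chart mmapX /mmap1 mdegE !big_ord_recl !big_ord0 /=.
have -> : lift ord0 ord0 = ord_max :> 'I_2 by apply: val_inj.
by rewrite mulr1 addn0 exprMn -polyC_exp mulrCA -exprD.
Qed.

Lemma mnm2P (m m' : 'X_{1..2}) :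
  mdeg m = mdeg m' -> m ord_max = m' ord_max -> m = m'.
Proof.
have e (u : 'X_{1..2}) : mdeg u = (u ord0 + u ord_max)%N.
  rewrite mdegE !big_ord_recl big_ord0 /= addn0; congr (_ + u _)%N; exact: val_inj.
rewrite !e => e1 e2; apply/mnmP => i; case: (ord2P i) => -> //.
by move: e1; rewrite e2 => /addIn.
Qed.

Lemma coef_chart h m : (chart h)`_(mdeg m)`_(m ord_max) = h@_m.
Proof.
rewrite [h in LHS]mpolyE rmorph_sum /= coef_sum coef_sum.
rewrite (eq_bigr (fun m' => h@_m' *+ (m' == m))) => [|m' _]; last first.
  rewrite -mul_mpolyC rmorphM /= chartC chartX mulrA -polyCM coefCM coefXn.
  case: (mdeg m =P mdeg m') => [e1|ne]; last first.
    by rewrite mulr0 coef0; case: eqP => // e; case: ne; rewrite e.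
  rewrite mulr1 coefCM coefXn mulr_natr; congr (_ *+ nat_of_bool _).
  by apply/eqP/eqP => [e2|->//]; exact/esym/mnm2P.
have [mh|mh] := boolP (m \in msupp h).
  rewrite (bigD1_seq m) //= ?msupp_uniq // eqxx big1 ?addr0 // => m' /negPf ->.
  by rewrite mulr0n.
rewrite (memN_msupp_eq0 mh) big_seq big1 // => m' m'h.
by case: eqP => [e|_]; rewrite ?mulr0n //; move: mh; rewrite -e m'h.
Qed.

Lemma size_chart h : size (chart h) = msize h.
Proof.
apply/eqP; rewrite eqn_leq; apply/andP; split.
  rewrite {1}[h]mpolyE rmorph_sum /=; apply: leq_trans (size_sum _ _ _) _.
  apply/bigmax_leqP_seq => m mh _; rewrite -mul_mpolyC rmorphM /= chartC chartX.
  rewrite mulrA -polyCM mul_polyC; apply: leq_trans (size_scale_leq _ _) _.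
  by rewrite size_polyXn msize_mdeg_lt.
rewrite msizeE; apply/bigmax_leqP_seq => m mh _; rewrite ltnNge; apply/negP => le.
by move: mh; rewrite mcoeff_msupp -coef_chart (nth_default _ le) coef0 eqxx.
Qed.

Lemma chart_eq0 h : (chart h == 0) = (h == 0).
Proof. by rewrite -size_poly_eq0 size_chart mmeasure_poly_eq0. Qed.

(** The chain rule for [h(t, s t)], with ['X] as [t] and ['X%:P] as [s]; [map_poly deriv] is the
    derivative in [s]. *)
Lemma deriv_chart h :
  (chart h)^`() = chart h^`M(ord0) + chart h^`M(ord_max) * 'X%:P.
Proof.
rewrite (@derivation_chain K _ chart (fun h => (chart h)^`())).
- by rewrite chartx charty derivX mulr1 derivM derivC mul0r add0r derivX mulr1.
- by move=> c; rewrite chartC derivC.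
- by move=> u v; rewrite rmorphD derivD.
- by move=> u v; rewrite rmorphM derivM.
Qed.

Lemma map_deriv_chart h : map_poly deriv (chart h) = chart h^`M(ord_max) * 'X.
Proof.
rewrite (@derivation_chain K _ chart (fun h => map_poly deriv (chart h))).
- have mX : map_poly (@deriv K) 'X = 0.
    by apply/polyP => i; rewrite coef_map coefX coef0 /=; case: (i == _); rewrite derivC.
  rewrite chartx charty map_poly_derivM mX map_polyC /= derivX !mulr0 mul1r.
  by rewrite add0r addr0.
- by move=> c; rewrite chartC map_polyC /= derivC.
- by move=> u v; rewrite rmorphD raddfD.
- by move=> u v; rewrite rmorphM map_poly_derivM.
Qed.

(** The factor ['X] is the Jacobian determinant [t] of the chart [(t, s t)]. *)
Lemma chart_jacobian u v :
  (chart u)^`() * map_poly deriv (chart v) - map_poly deriv (chart u) * (chart v)^`()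
  = 'X * chart (jacobian u v).
Proof.
have E (R : comNzRingType) (a b c d s t : R) :
  (a + b * s) * (d * t) - b * t * (c + d * s) = t * (a * d - b * c) by ring.
by rewrite !deriv_chart !map_deriv_chart E /jacobian rmorphB !rmorphM.
Qed.

Lemma chartZ c h : chart (c *: h) = c%:P%:P * chart h.
Proof. by rewrite -mul_mpolyC rmorphM -chartC. Qed.

Lemma chartBZX u v c q :
  chart (u - c *: v ^+ q) = chart u - c%:P%:P * chart v ^+ q.
Proof. by rewrite rmorphB /= chartZ rmorphXn. Qed.
End LeadingForm.

(** * A degree estimate of Shestakov-Umirbaev type *)

Lemma derivn_root_mult (R : comNzRingType) (T : {poly R}) b k :
  (T * ('X - b%:P) ^+ k)^`(k).[b] = T.[b] *+ k`!.
Proof.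
elim: k T => [|k IH] T; first by rewrite expr0 mulr1 derivn0 mulr1n.
rewrite derivSn derivM deriv_exp derivXsubC mul1r /= exprS mulrA mulrnAr -mulrnAl -mulrDl IH.
by rewrite hornerD hornerM !hornerXsubC subrr mulr0 add0r hornerMn -mulrnA factS.
Qed.

Lemma coefX_top (R : nzRingType) (U : {poly R}) m i : (size U <= m.+1)%N ->
  (size (U ^+ i) <= (m * i).+1)%N /\ (U ^+ i)`_(m * i) = U`_m ^+ i.
Proof.
move=> sU; elim: i => [|i [sI cI]]; first by rewrite !expr0 muln0 size_polyC oner_eq0 coefC.
rewrite !exprS mulnS coefM_top // cI; split=> //.
by apply: leq_trans (size_polyMleq _ _) _; move: sU sI; lia.
Qed.

(* If the exponents of [L] lie in [j1 + p N], then [L = 'X^j1 * H('X^p)], and a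
   nonzero root of [L] is only as multiple as its [p]-th power is in [H]. *)
Lemma lacunary_root_mult (E : idomainType) (L : {poly E}) (b : E) p j1 :
  [pchar E] =i pred0 -> (0 < p)%N -> L != 0 -> b != 0 ->
  (forall j, L`_j != 0 -> (j1 <= j)%N && (p %| j - j1)%N) ->
  exists2 k, L^`(k).[b] != 0 & (j1 + p * k <= (size L).-1)%N.
Proof.
move=> ch0 p0 L0 b0 supL.
pose H := \poly_(i < size L) L`_(j1 + p * i).
have eL : L = 'X^j1 * (H \Po 'X^p).
  apply/polyP => j; rewrite coefXnM; case: ltnP => [lt|le].
    by apply/eqP; apply: contraTT lt => /supL /andP[le _]; rewrite -leqNgt.
  rewrite coef_comp_poly_Xn // coef_poly; case: ifPn => [dv|ndv]; last first.
    by apply/eqP; apply: contraNT ndv => /supL /andP[].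
  rewrite mulnC divnK // subnKC //; case: ltnP => // le2.
  rewrite nth_default //; apply: leq_trans le2 _; apply: leq_trans (leq_div _ _) _.
  exact: leq_subr.
have H0 : H != 0 by apply: contraNneq L0 => H0; rewrite eL H0 comp_poly0 mulr0.
have [k [S]] := multiplicity_XsubC H (b ^+ p); rewrite H0 /= => rS eH.
have S0 : S != 0 by apply: contraNneq H0 => S0; rewrite eH S0 mul0r.
(* ['X^p - b^p] is ['X - b] times the sum below, whose value [p b^(p-1)] at [b] is nonzero in
   characteristic zero. Since [S] does not vanish at [b^p], neither does [T] at [b]. *)
pose T := 'X^j1 * (S \Po 'X^p) * (\sum_(i < p) 'X^(p.-1 - i) * b%:P ^+ i) ^+ k.
have eLT : L = T * ('X - b%:P) ^+ k.
  rewrite /T -!mulrA -exprMn [X in X ^+ k]mulrC -subrXX.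
  by rewrite eL eH comp_polyM rmorphXn /= rmorphB /= comp_polyX comp_polyC polyC_exp.
exists k.
  rewrite eLT derivn_root_mult -mulr_natr mulf_neq0 //; last first.
    by rewrite pcharf0P // in ch0 *; rewrite ch0 -lt0n fact_gt0.
  rewrite /T !hornerM hornerXn horner_comp hornerXn horner_exp !mulf_neq0 ?expf_neq0 //.
  rewrite horner_sum (eq_bigr (fun=> b ^+ p.-1)) => [|i _].
    rewrite sumr_const card_ord -mulr_natr mulf_neq0 ?expf_neq0 //.
    by have /pcharf0P -> := ch0; rewrite -lt0n.
  rewrite hornerM hornerXn horner_exp hornerC -exprD subnK //.
  by have := ltn_ord i; lia.
have : L`_(j1 + p * (size H).-1) != 0.
  have := H0; rewrite -lead_coef_eq0 lead_coefE /H coef_poly.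
  by case: ifP => // _; rewrite eqxx.
have sk : (k <= (size H).-1)%N.
  rewrite eH size_Mmonic ?monic_exp ?monicXsubC // size_exp_XsubC addnS /=.
  by rewrite -subn1 leq_subRL ?addn_gt0 ?size_poly_gt0 ?S0 // leq_add2r size_poly_gt0.
move=> nz; apply: leq_trans (_ : j1 + p * (size H).-1 <= _)%N.
  by rewrite leq_add2l leq_mul2l sk orbT.
by rewrite leqNgt; apply: contraNN nz => lt; rewrite nth_default //; move: lt; case: (size L).
Qed.

Lemma seq_argmax (T : eqType) (w : T -> nat) (s : seq T) (v : T) : v \in s ->
  exists2 u, u \in s & forall u', u' \in s -> (w u' <= w u)%N.
Proof.
elim: s v => // v s IH v0 _.
case: s IH => [|v' s] IH; first by exists v; rewrite ?mem_head // => u; rewrite inE => /eqP->.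
have [u us umax] := IH v' (mem_head _ _).
have [le|lt] := leqP (w v) (w u).
  exists u => [|u']; first by rewrite in_cons us orbT.
  by rewrite in_cons => /predU1P[->//|]; apply: umax.
exists v; rewrite ?mem_head // => u'; rewrite in_cons => /predU1P[->//|/umax].
by move/leq_trans; apply; exact: ltnW.
Qed.

Section DegreeEstimate.
Variable K : numFieldType.
Local Notation A := {mpoly K[2]}.
Local Notation x := ('X_ord0 : A).
Local Notation y := ('X_ord_max : A).

Lemma size_map_deriv (R : nzRingType) (U : {poly {poly R}}) :
  (size (map_poly deriv U) <= size U)%N.
Proof. exact: size_poly. Qed.

Lemma size_deriv_pred (R : nzRingType) (U : {poly R}) :
  (size U^`() <= (size U).-1)%N.
Proof. exact: size_poly. Qed.

(** In degrees the bound is deg u + deg v - 2: in the chart, the derivative in [t] lowers the degree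
    by one, and the Jacobian carries an extra factor ['X]. *)
Lemma msize_jacobian (u v : A) :
  jacobian u v != 0 -> (msize (jacobian u v) + 3 <= msize u + msize v)%N.
Proof.
move=> j0; have := chart_jacobian u v => /(congr1 (fun p : {poly {poly K}} => size p)).
rewrite ['X * _]mulrC size_mulX ?chart_eq0 // size_chart => e.
have u0 : (0 < msize u)%N.
  rewrite lt0n mmeasure_poly_eq0; apply: contraNneq j0 => ->.
  by rewrite /jacobian !mderiv0 !mul0r subrr.
have v0 : (0 < msize v)%N.
  rewrite lt0n mmeasure_poly_eq0; apply: contraNneq j0 => ->.
  by rewrite /jacobian !mderiv0 !mulr0 subrr.
have jac0 : (0 < msize (jacobian u v))%N by rewrite lt0n mmeasure_poly_eq0.
suff le : ((msize (jacobian u v)).+1 <= msize u + msize v - 2)%N.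
  by move: le u0 v0; move: (msize (jacobian u v)) (msize u) (msize v); clear; lia.
have su := size_deriv_pred (chart u); have sv := size_deriv_pred (chart v).
have su' := size_map_deriv (chart u); have sv' := size_map_deriv (chart v).
rewrite !size_chart in su sv su' sv'.
rewrite -e; apply: leq_trans (size_polyD _ _) _; rewrite size_polyN geq_max.
apply/andP; split; apply: leq_trans (size_polyMleq _ _) _.
  move: su sv' u0 v0; move: (msize u) (msize v) (size _) (size _); clear; lia.
move: su' sv u0 v0; move: (msize u) (msize v) (size _) (size _); clear; lia.
Qed.

Section Estimate.
Variables (f : {lrmorphism A -> A}) (c : K).
Hypotheses (c0 : c != 0) (jf : jacobian (f x) (f y) = c%:MP).

(** This transports the derivative in [y] through [f], so that each such derivative changes the
    degree after [f] by at most the degree of [f x] minus 2. *)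
Lemma jacobian_partial h : jacobian (f x) (f h) = c *: f h^`M(ord_max).
Proof. by rewrite jacobian_comp_r jacobianvv mulr0 add0r jf mulrC mul_mpolyC. Qed.

Lemma deg_partial h : f h^`M(ord_max) != 0 ->
  (total_degree (f h^`M(ord_max)) + 2 <= total_degree (f x) + total_degree (f h))%N.
Proof.
move=> fh0; have := @msize_jacobian (f x) (f h).
rewrite jacobian_partial msizeZ // scaler_eq0 negb_or c0 fh0 => /(_ isT).
have : (0 < msize (f h^`M(ord_max)))%N by rewrite lt0n mmeasure_poly_eq0.
rewrite /total_degree; move: (msize _) (msize _) (msize _) => *; lia.
Qed.

Lemma deg_partialn h k : f h^`M(ord_max, k) != 0 ->
  (total_degree (f h^`M(ord_max, k)) + 2 * k <= total_degree (f x) * k + total_degree (f h))%N.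
Proof.
elim: k => [|k IH]; first by rewrite mderivn0 !muln0 addn0.
rewrite mderivnS => nz; have := deg_partial nz.
have /IH : f h^`M(ord_max, k) != 0.
  apply: contraNneq nz => e; have := jacobian_partial h^`M(ord_max, k).
  by rewrite e (jacobianCr _ 0) => /esym/eqP; rewrite scaler_eq0 (negPf c0).
move: (total_degree _) (total_degree _) (total_degree _) (total_degree _) => *; lia.
Qed.

Lemma chart_comp_X u :
  chart (f 'X_[u]) = chart (f x) ^+ u ord0 * chart (f y) ^+ u ord_max.
Proof.
have -> : 'X_[u] = x ^+ u ord0 * y ^+ u ord_max.
  rewrite mpolyXE_id !big_ord_recl big_ord0 mulr1.
  by have -> : lift ord0 ord0 = ord_max :> 'I_2 by apply: val_inj.
by rewrite !rmorphM !rmorphXn.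
Qed.

(* The top part of [G] for the weights [m], [n], with the leading form of [f x]
   substituted for [x]. *)
Definition top_part (m n w : nat) (G : A) : {poly {poly K}} :=
  \sum_(u <- msupp G | (m * u ord0 + n * u ord_max == w)%N)
     (G@_u *: (chart (f x))`_m ^+ u ord0) *: 'X^(u ord_max).

(** The derivatives lower weights by [n k], so only monomials of [G] of top weight reach degree [w],
    each through the leading forms of [f x] and [f y]. *)
Lemma coef_chart_partial m n w k G :
  (msize (f x) <= m.+1)%N -> (msize (f y) <= n.+1)%N ->
  (forall u, u \in msupp G -> (m * u ord0 + n * u ord_max <= w + n * k)%N) ->
  (chart (f G^`M(ord_max, k)))`_w
  = (top_part m n (w + n * k) G)^`(k).[(chart (f y))`_n].
Proof.
move=> sx sy sG; rewrite -!size_chart in sx sy.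
rewrite mderivnE !rmorph_sum /= coef_sum /top_part raddf_sum /= horner_sum.
rewrite [RHS]big_mkcond /= !big_seq; apply: eq_bigr => u /sG uG.
rewrite -mul_mpolyC rmorphM /= lrmorphC rmorphM /= chartC chart_comp_X coefCM.
rewrite !mnmBE !mulmnE !mnm1E eqxx /= mul1n mul0n subn0.
have [lt|le] := ltnP (u ord_max) k.
  rewrite ffact_small // mul0r polyC0 mul0r; case: ifP => // _.
  by rewrite derivnZ derivnXn ffact_small // mulr0n scaler0 horner0.
have [sF cF] := coefX_top (u ord0) sx; have [sH cH] := coefX_top (u ord_max - k)%N sy.
have ew : (m * u ord0 + n * (u ord_max - k) + n * k = m * u ord0 + n * u ord_max)%N.
  by rewrite -addnA -mulnDr subnK.
case: eqP => [ew'|ne].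
  have -> : w = (m * u ord0 + n * (u ord_max - k))%N by lia.
  rewrite coefM_top // cF cH derivnZ hornerZ derivnXn hornerMn hornerXn.
  by rewrite polyCM rmorph_nat -mul_polyC mulrnAr -[RHS]mulr_natl -!mulrA.
rewrite nth_default ?mulr0 //; apply: leq_trans (size_polyMleq _ _) _.
move: sF sH ew uG ne; clear; move: (size _) (size _) => a b.
move: (m * _)%N (n * _)%N (n * _)%N (n * _)%N; lia.
Qed.

Lemma coef_top_part m n w G j : (top_part m n w G)`_j =
  \sum_(u <- msupp G | (m * u ord0 + n * u ord_max == w)%N && (u ord_max == j))
    G@_u *: (chart (f x))`_m ^+ u ord0.
Proof.
rewrite /top_part coef_sum big_mkcondr /=; apply: eq_bigr => u _.
by rewrite coefZ coefXn eq_sym; case: eqP; rewrite ?mulr1 ?mulr0.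
Qed.

Lemma top_part_supp m n w G j : (top_part m n w G)`_j != 0 ->
  exists u, [/\ u \in msupp G, (m * u ord0 + n * u ord_max = w)%N & u ord_max = j].
Proof.
rewrite coef_top_part => nz; have /hasP[u uG /andP[/eqP eu /eqP ej]] :
    has (fun u : 'X_{1..2} => (m * u ord0 + n * u ord_max == w)%N && (u ord_max == j))
      (msupp G).
  by apply: contraNT nz => /hasPn no; rewrite big_seq_cond big1 // => u /andP[/no /negPf ->].
by exists u.
Qed.

(** As [m] is positive, the weight and the exponent of [y] determine a monomial, so a single term
    makes up this coefficient. *)
Lemma top_part_neq0 m n G u : (0 < m)%N -> u \in msupp G -> (chart (f x))`_m != 0 ->
  (top_part m n (m * u ord0 + n * u ord_max) G)`_(u ord_max) != 0.
Proof.
move=> m0 uG a0; rewrite coef_top_part -big_filter.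
set s := seq.filter _ _.
have -> : \sum_(i <- s) G@_i *: (chart (f x))`_m ^+ i ord0 =
    \sum_(i <- [:: u]) G@_i *: (chart (f x))`_m ^+ i ord0.
  apply: perm_big; apply: uniq_perm; rewrite ?filter_uniq ?msupp_uniq // => v.
  rewrite mem_filter inE; apply/idP/eqP => [/andP[/andP[/eqP e /eqP ev] _]|->].
    apply/mnmP => i; case: (ord2P i) => -> //; move: e; rewrite ev => /addIn /eqP.
    by rewrite eqn_mul2l => /orP[|/eqP//]; case: (m) m0.
  by rewrite !eqxx.
by rewrite big_seq1 scaler_eq0 negb_or -mcoeff_msupp uG expf_neq0.
Qed.

(* The inequality of Shestakov and Umirbaev, for two Jacobian partners: [k] is
   the multiplicity of the leading form of [f y] as a root of the top weighted
   part of [G], and differentiating [k] times in [y] removes the cancellation. *)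
Lemma degree_estimate (G : A) : G != 0 ->
  let m := total_degree (f x) in let n := total_degree (f y) in
  (0 < m)%N -> (0 < n)%N ->
  exists k, [/\
    forall u, u \in msupp G ->
      (m * u ord0 + n * u ord_max + 2 * k <= k * (m + n) + total_degree (f G))%N,
    exists2 u, u \in msupp G & (m %/ gcdn m n * k <= u ord_max)%N
  & exists2 u, u \in msupp G & (n %/ gcdn m n * k <= u ord0)%N].
Proof.
move=> G0 m n m0 n0.
pose wt (u : 'X_{1..2}) := (m * u ord0 + n * u ord_max)%N.
have sx : msize (f x) = m.+1 by rewrite prednK //; move: m0; rewrite /m /total_degree;
  case: (msize _).
have sy : msize (f y) = n.+1 by rewrite prednK //; move: n0; rewrite /n /total_degree;
  case: (msize _).
have a0 : (chart (f x))`_m != 0.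
  by rewrite /m /total_degree -size_chart -lead_coefE lead_coef_eq0 -size_poly_eq0 size_chart
    sx.
have b0 : (chart (f y))`_n != 0.
  by rewrite /n /total_degree -size_chart -lead_coefE lead_coef_eq0 -size_poly_eq0 size_chart
    sy.
have [u0 u0G u0max] :
    exists2 u0, u0 \in msupp G & forall u, u \in msupp G -> (wt u <= wt u0)%N.
  exact: seq_argmax (mlead_supp G0).
pose w := wt u0; pose L := top_part m n w G.
have Lu0 : L`_(u0 ord_max) != 0 by apply: top_part_neq0.
have L0 : L != 0 by apply: contraNneq Lu0 => ->; rewrite coef0.
have exj : exists j, L`_j != 0 by exists (u0 ord_max).
(* [u1] and [u2] carry the lowest and the highest power of [y] in the top part. *)
case: (ex_minnP exj) => j1 /top_part_supp[u1 [u1G wu1 eu1]] j1min.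
have [u2 [u2G wu2 eu2]] :
    exists u, [/\ u \in msupp G, wt u = w & u ord_max = (size L).-1].
  by apply: top_part_supp; rewrite -/L -lead_coefE lead_coef_eq0.
have g0 : (0 < gcdn m n)%N by rewrite gcdn_gt0 m0.
have em : (m = m %/ gcdn m n * gcdn m n)%N by rewrite divnK // dvdn_gcdl.
have en : (n = n %/ gcdn m n * gcdn m n)%N by rewrite divnK // dvdn_gcdr.
have cop : coprime (m %/ gcdn m n) (n %/ gcdn m n).
  by rewrite /coprime -(eqn_pmul2r g0) muln_gcdl mul1n -em -en.
have p0 : (0 < m %/ gcdn m n)%N by rewrite divn_gt0 // dvdn_leq // dvdn_gcdl.
(* For monomials of equal weight, [m] divides [n] times the difference of the [y]-exponents;
   dividing by the gcd gives the lacunary shape of [L]. *)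
have supL j : L`_j != 0 -> (j1 <= j)%N && (m %/ gcdn m n %| j - j1)%N.
  move=> Lj; have le := j1min j Lj; rewrite le /=.
  have [u [_ wu eu]] := top_part_supp Lj.
  rewrite -(Gauss_dvdr _ cop) -(dvdn_pmul2r g0) -em mulnAC -en mulnBr.
  have -> : (n * j - n * j1 = m * u1 ord0 - m * u ord0)%N.
    by move: (etrans wu1 (esym wu)); rewrite eu1 eu; clear; lia.
  by rewrite -mulnBr dvdn_mulr.
have [|k kL kle] := lacunary_root_mult _ p0 L0 b0 supL.
  by move=> r; rewrite !pchar_poly; apply: pchar_num.
exists k; split.
- have kle2 : (n * k <= w)%N.
    rewrite -wu2 /wt eu2; apply: leq_trans (leq_addl _ _); rewrite leq_mul2l.
    by rewrite (leq_trans _ kle) ?orbT //; apply: leq_trans (leq_pmull _ p0) (leq_addl _ _).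
  have := @coef_chart_partial m n (w - n * k)%N k G.
  rewrite sx sy subnK // => /(_ (leqnn _) (leqnn _) u0max) ecoef.
  have nz : (chart (f G^`M(ord_max, k)))`_(w - n * k) != 0 by rewrite ecoef.
  have lt : (w - n * k < msize (f G^`M(ord_max, k)))%N.
    by rewrite -size_chart ltnNge; apply: contraNN nz => le; rewrite nth_default.
  have := @deg_partialn G k; rewrite -chart_eq0.
  have -> : chart (f G^`M(ord_max, k)) != 0 by apply: contraNneq nz => ->; rewrite coef0.
  move=> /(_ isT); rewrite -/m => le2 u /u0max; rewrite -/w -/(wt u).
  have : (w - n * k <= total_degree (f G^`M(ord_max, k)))%N.
    by rewrite /total_degree; move: lt; case: (msize _).
  move: le2 kle2; rewrite mulnDr [(k * m)%N]mulnC [(k * n)%N]mulnC; clear; lia.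
- by exists u2 => //; rewrite eu2 (leq_trans _ kle) // leq_addl.
(* By equality of weights, [u1] exceeds [u2] in the exponent of [x] by [n / m] times what it lacks
   in the exponent of [y], and it lacks at least [(m / gcd m n) k]. *)
exists u1 => //; rewrite -(leq_pmul2l m0).
have -> : (m * (n %/ gcdn m n * k) = n * (m %/ gcdn m n * k))%N.
  by rewrite !mulnA muln_divCA_gcd.
have : (n * j1 + n * (m %/ gcdn m n * k) <= n * (size L).-1)%N.
  by rewrite -mulnDr leq_mul2l kle orbT.
move: (etrans wu1 (esym wu2)); rewrite /wt eu1 eu2; clear; lia.
Qed.
End Estimate.
End DegreeEstimate.

(** * Degrees of the coordinates of an automorphism *)

Section Automorphisms.
Variable K : numFieldType.
Local Notation A := {mpoly K[2]}.
Local Notation x := ('X_ord0 : A).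
Local Notation y := ('X_ord_max : A).

Definition partial_deg (i : 'I_2) (h : A) : nat := \max_(u <- msupp h) u i.

Lemma total_degX i : total_degree ('X_i : A) = 1%N.
Proof. by rewrite /total_degree msizeX mdeg1. Qed.

Lemma total_degC c : total_degree (c%:MP : A) = 0%N.
Proof. by rewrite /total_degree mmeasureC; case: (_ != _). Qed.

Lemma total_deg_eq0 (h : A) : total_degree h = 0%N -> h = (h@_0)%:MP.
Proof. by move=> h0; apply: msize1_polyC; move: h0; rewrite /total_degree;
  case: (msize h) => [|[]]. Qed.

Lemma total_deg_auto_gt0 (f g : {lrmorphism A -> A}) h :
  cancel f g -> (0 < total_degree h)%N -> (0 < total_degree (f h))%N.
Proof.
move=> fK; rewrite !lt0n; apply: contraNneq => /total_deg_eq0 e.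
by rewrite -(fK h) e lrmorphC total_degC.
Qed.

(* Apply the estimate to [G = g x], for which [f G = x] has degree 1: if the
   degree [m] of [f x] did not divide the degree [n] of [f y], then
   [m / gcd m n >= 2] would force [k = 0] and [G] to be constant. *)
Lemma auto_deg_dvd (f g : {lrmorphism A -> A}) : cancel f g -> cancel g f ->
  (total_degree (f x) <= total_degree (f y))%N -> (total_degree (f x) %| total_degree (f y))%N.
Proof.
move=> fK gK le; have [c c0 jf] := jacobian_auto gK.
have m0 : (0 < total_degree (f x))%N by apply: total_deg_auto_gt0 fK _; rewrite total_degX.
have n0 : (0 < total_degree (f y))%N by apply: total_deg_auto_gt0 fK _; rewrite total_degX.
have G0 : g x != 0.
  by rewrite raddf_eq0 -?(mmeasure_poly_eq0 mdeg) ?msizeX //; apply: can_inj gK.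
have [k []] := degree_estimate c0 jf G0 m0 n0; rewrite gK total_degX.
set m := total_degree (f x) in le m0 *; set n := total_degree (f y) in le n0 * => est [u uG
  ku] _.
have [p1|p2] := leqP (m %/ gcdn m n) 1.
  have em : gcdn m n = m.
    have := divnK (dvdn_gcdl m n); move: p1 m0; case: (m %/ _)%N => [|[|]] //.
      by move=> _ /[swap] <-; rewrite mul0n.
    by rewrite mul1n.
  by rewrite -[X in (X %| _)%N]em dvdn_gcdr.
(* With [u ord_max >= 2 k] and [m <= n], the estimate yields [2 k n + 2 k <= 2 k n + 1]. *)
have k0 : k = 0%N.
  have := est u uG.
  have : (n * (2 * k) <= n * u ord_max)%N.
    by rewrite leq_mul2l (leq_trans _ ku) ?orbT // leq_mul2r p2 orbT.
  have : (k * m <= k * n)%N by rewrite leq_mul2l le orbT.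
  by clear; rewrite mulnDr; move: (m * _)%N => a; lia.
have m2 : (1 < m)%N by apply: leq_trans p2 (leq_div _ _).
have supp0 v : v \in msupp (g x) -> v = 0%MM.
  move=> /est; rewrite k0 mul0n muln0 addn0 add0n => lt; apply/mnmP => i.
  have v0 : v ord0 = 0%N.
    by case: (v ord0) lt => // j; move: m2; clear; nia.
  have v1 : v ord_max = 0%N.
    by case: (v ord_max) lt => // j; move: m2 le; clear; nia.
  by rewrite mnm0E; case: (ord2P i) => ->.
suff : total_degree (g x) = 0%N.
  by move/total_deg_eq0 => e; move: (total_degX ord0); rewrite -(gK x) e lrmorphC total_degC.
rewrite /total_degree msizeE; apply/eqP; rewrite -leqn0 -ltnS;
  case E: (\max_(_ <- _) _) => [|r] //=.
rewrite -E; apply/bigmax_leqP_seq => v /supp0 -> _; by rewrite mdeg0.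
Qed.

(* Any ratio below 1 in place of [3 / 4] would do: this estimate and its mirror
   image under [swap] together must bound both partial degrees. *)
Lemma deg_comp_ge (f : {lrmorphism A -> A}) c G :
  c != 0 -> jacobian (f x) (f y) = c%:MP ->
  (0 < total_degree (f x))%N -> (2 * total_degree (f x) <= total_degree (f y))%N -> G != 0 ->
  (4 * (total_degree (f y) * partial_deg ord_max G)
   <= 4 * total_degree (f G) + 3 * (total_degree (f y) * partial_deg ord0 G))%N.
Proof.
move=> c0 jf m0 le G0; have n0 : (0 < total_degree (f y))%N by move: m0 le; lia.
have [k []] := degree_estimate c0 jf G0 m0 n0.
move: m0 le n0; set m := total_degree (f x);
  set n := total_degree (f y) => m0 le n0 est _ [u uG ku].
have dx : (n %/ gcdn m n * k <= partial_deg ord0 G)%N.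
  by apply: leq_trans ku _; rewrite /partial_deg (bigD1_seq u) ?msupp_uniq //= leq_maxl.
have [v vG vmax] := seq_argmax (fun v : 'X_{1..2} => v ord_max) uG.
have dy : (partial_deg ord_max G <= v ord_max)%N by apply/bigmax_leqP_seq => v' /vmax.
(* The ratio 3/4 is 3/2 times 1/2: [k (m + n)] is at most [3/2 k n], and [k n] is at most half of
   [n] times the [x]-degree, because [gcd m n <= m <= n / 2]. *)
have nk : (n * k <= gcdn m n * partial_deg ord0 G)%N.
  by rewrite -[X in (X * k)%N](divnK (dvdn_gcdr m n)) mulnAC [X in (X <= _)%N]mulnC leq_mul2l
    dx orbT.
have gm : (2 * gcdn m n <= n)%N by apply: leq_trans le; rewrite leq_mul2l dvdn_leq ?dvdn_gcdl.
have := est v vG.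
have : (n * partial_deg ord_max G <= n * v ord_max)%N by rewrite leq_mul2l dy orbT.
have : (2 * gcdn m n * partial_deg ord0 G <= n * partial_deg ord0 G)%N by rewrite leq_mul2r
  gm orbT.
have : (k * (2 * m) <= k * n)%N by rewrite leq_mul2l le orbT.
move: nk; rewrite mulnDr [(n * k)%N]mulnC -mulnA [(k * (2 * m))%N]mulnCA; clear.
by move: (total_degree _) => d; lia.
Qed.

(* The Jacobian of the two leading forms vanishes, so that of [f y] is a
   constant multiple of a power of that of [f x]. *)
Lemma leading_form_power (f : {lrmorphism A -> A}) c q :
  jacobian (f x) (f y) = c%:MP -> (0 < total_degree (f x))%N ->
  total_degree (f y) = (total_degree (f x) * q)%N ->
  (2 < total_degree (f x) + total_degree (f y))%N ->
  (0 < q)%N -> exists d, (msize (f y - d *: f x ^+ q) < msize (f y))%N.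
Proof.
move=> jf m0 en lt q0.
set m := total_degree (f x) in m0 en lt; set n := total_degree (f y) in en lt.
have n0 : (0 < n)%N by rewrite en muln_gt0 m0.
have sx : size (chart (f x)) = m.+1.
  by rewrite size_chart prednK //; move: m0; rewrite /m /total_degree; case: (msize _).
have sy : size (chart (f y)) = n.+1.
  by rewrite size_chart prednK //; move: n0; rewrite /n /total_degree; case: (msize _).
have eJ := chart_jacobian (f x) (f y).
move eF : (chart (f x)) sx eJ => F sx; move eH : (chart (f y)) sy => H sy eJ.
have F0 : F`_m != 0 by rewrite -[m]/(m.+1.-1) -sx -lead_coefE lead_coef_eq0 -size_poly_eq0 sx.
have sF' : (size F^`() <= m.-1.+1)%N by rewrite prednK // (leq_trans (size_deriv_pred _)) ?sx.
have sH' : (size H^`() <= n.-1.+1)%N by rewrite prednK // (leq_trans (size_deriv_pred _)) ?sy.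
have sFs : (size (map_poly deriv F) <= m.+1)%N by rewrite -sx size_map_deriv.
have sHs : (size (map_poly deriv H) <= n.+1)%N by rewrite -sy size_map_deriv.
(* On the right only the coefficient at 1 can be nonzero, and [m.-1 + n] is not 1 because [m + n]
   exceeds 2. *)
have := congr1 (fun p : {poly {poly K}} => p`_(m.-1 + n)) eJ.
rewrite coefB jf chartC coefXM coefC (coefM_top sF' sHs).
have -> : ((m.-1 + n).-1 == 0)%N = false by move: m0 n0 lt; clear; lia.
have -> : (m.-1 + n = m + n.-1)%N by move: m0 n0; clear; lia.
rewrite (coefM_top sFs sH') if_same !coef_deriv !coef_map /= !prednK //.
move=> /eqP; rewrite subr_eq0 => /eqP ew.
have {}ew : F`_m * (H`_n)^`() = ((F`_m)^`() * H`_n) *+ q.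
  have : F`_m * (H`_n)^`() * m%:R = ((F`_m)^`() * H`_n) *+ q * m%:R.
    by rewrite !mulr_natr -mulrnA [(q * m)%N]mulnC -en -[RHS]mulrnAr -ew mulrnAl.
  by apply: mulIf; rewrite -polyC_natr polyC_eq0 pnatr_eq0 -lt0n.
have [||d ed] := @wronskian_eq0 K (H`_n) (F`_m ^+ q).
- by rewrite expf_neq0.
- rewrite deriv_exp -{1}(prednK q0) exprS mulrA [_^`() * F`_m]mulrC ew.
  by rewrite mulrnAl mulrnAr; congr (_ *+ _); rewrite [RHS]mulrCA mulrA.
have eh : chart (f y - d *: f x ^+ q) = H - d%:P%:P * F ^+ q.
  by rewrite chartBZX eF eH.
exists d; rewrite -[msize (f y)]size_chart eH sy ltnS -size_chart eh.
apply/leq_sizeP => j; rewrite leq_eqVlt coefB coefCM.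
have [sF cF] := coefX_top q (eq_leq sx).
case/predU1P => [<-|lt2]; first by rewrite {2}en cF ed mul_polyC subrr.
by rewrite !nth_default ?mulr0 ?subrr // ?sy //; apply: leq_trans sF _; rewrite -en.
Qed.
End Automorphisms.

(** * Tameness and normal forms in the automorphism group *)

Section Tame.
Variable K : numFieldType.
Local Notation A := {mpoly K[2]}.
Local Notation x := ('X_ord0 : A).
Local Notation y := ('X_ord_max : A).

Definition subst (u v : A) : A -> A := comp_mpoly [tuple u; v].
HB.instance Definition _ u v := GRing.LRMorphism.copy (subst u v) (comp_mpoly [tuple u; v]).

Lemma substx u v : subst u v x = u.
Proof. by rewrite /subst comp_mpolyXU. Qed.

Lemma substy u v : subst u v y = v.
Proof. by rewrite /subst comp_mpolyXU. Qed.

Lemma lrmorph_eq (f g : {lrmorphism A -> A}) :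
  f x = g x -> f y = g y -> f = g :> (A -> A).
Proof. by move=> ex ey; apply/funext; apply: lrmorph_ext. Qed.

Lemma lrmorph_horner (f : {lrmorphism A -> A}) u p :
  f (horner_alg u p) = horner_alg (f u) p.
Proof.
elim/poly_ind: p => [|p c IH]; first by rewrite !rmorph0.
by rewrite !rmorphD !rmorphM /= !horner_algX !horner_algC IH linearZ rmorph1.
Qed.

Lemma horner_alg_comp (u : A) p q : horner_alg u (p \Po q) = horner_alg (horner_alg u q) p.
Proof.
elim/poly_ind: p => [|p c IH]; first by rewrite comp_poly0 !rmorph0.
by rewrite comp_polyD comp_polyM comp_polyX comp_polyC !rmorphD !rmorphM /= !horner_algX
  !horner_algC IH.
Qed.

Definition swap : A -> A := subst y x.
HB.instance Definition _ := GRing.LRMorphism.on swap.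

Lemma swapK : involutive swap.
Proof.
by apply: (@lrmorph_ext _ (swap \o swap) idfun) => /=; rewrite /swap !(substx, substy).
Qed.

Record letter := Letter { lx : K; lx0 : K; ly : K; lpol : {poly K} }.

Definition valid (d : letter) := (lx d != 0) && (ly d != 0).
Definition strict (d : letter) := valid d && (2 < size (lpol d))%N.

Definition tri (d : letter) : A -> A :=
  subst (lx d *: x + (lx0 d)%:MP) (ly d *: y + horner_alg x (lpol d)).
HB.instance Definition _ d := GRing.LRMorphism.on (tri d).

Lemma trix d : tri d x = lx d *: x + (lx0 d)%:MP.
Proof. exact: substx. Qed.

Lemma triy d : tri d y = ly d *: y + horner_alg x (lpol d).
Proof. exact: substy. Qed.

Lemma swapx : swap x = y. Proof. exact: substx. Qed.
Lemma swapy : swap y = x. Proof. exact: substy. Qed.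

Definition lone := Letter 1 0 1 0.

Lemma tri_one : tri lone = id.
Proof.
apply: (@lrmorph_eq (tri lone) idfun) => /=; rewrite (trix, triy) /= scale1r.
  by rewrite mpolyC0 addr0.
by rewrite rmorph0 addr0.
Qed.

Definition lmul d e := Letter (lx d * lx e) (lx e * lx0 d + lx0 e) (ly d * ly e)
  (ly e *: lpol d + (lpol e \Po (lx d *: 'X + (lx0 d)%:P))).

Lemma horner_algMC (u : A) c : horner_alg u c%:P = c%:MP.
Proof. by rewrite horner_algC -mul_mpolyC mulr1. Qed.

Lemma horner_algZ (u : A) a p : horner_alg u (a *: p) = a *: horner_alg u p.
Proof. by rewrite -mul_polyC rmorphM /= horner_algC mulr_algl. Qed.

Lemma horner_alg_lin (u : A) a b : horner_alg u (a *: 'X + b%:P) = a *: u + b%:MP.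
Proof.
rewrite -mul_polyC rmorphD rmorphM /= !horner_algC horner_algX mulr_algl.
by rewrite -[b *: 1]mul_mpolyC mulr1.
Qed.

Lemma valid_lmul d e : valid d -> valid e -> valid (lmul d e).
Proof. by move=> /andP[? ?] /andP[? ?]; rewrite /valid !mulf_neq0. Qed.

Lemma tri_lmul d e : tri (lmul d e) = tri d \o tri e.
Proof.
apply: (@lrmorph_eq (tri (lmul d e)) (tri d \o tri e)) => /=.
  rewrite !trix linearD linearZ /= lrmorphC trix scalerDr scalerA mulrC -addrA.
  by rewrite mpolyCD mpolyCM mul_mpolyC.
rewrite [LHS]triy /= rmorphD /= horner_algZ horner_alg_comp horner_alg_lin.
rewrite triy linearD linearZ /= triy lrmorph_horner /= trix scalerDr scalerA.
by rewrite [ly e * _]mulrC -addrA.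
Qed.

Definition linv d :=
  let q := (lx d)^-1 *: 'X + (- (lx0 d / lx d))%:P in
  Letter (lx d)^-1 (- (lx0 d / lx d)) (ly d)^-1 (- ((ly d)^-1 *: (lpol d \Po q))).

Lemma linvlK d : valid d -> lmul (linv d) d = lone.
Proof.
case: d => a b c p /andP[/= a0 c0]; rewrite /lmul /linv /lone /= !mulVf //.
rewrite mulrN mulrCA divff // mulr1 addNr; congr Letter.
by rewrite scalerN scalerA divff // scale1r addNr.
Qed.

Lemma strict_linv d : strict d -> strict (linv d).
Proof.
case: d => a b c p /andP[/andP[/= a0 c0] sp]; rewrite /strict /valid /= !invr_eq0 a0 c0 /=.
rewrite size_polyN size_scale ?invr_eq0 // size_comp_poly2 //.
rewrite size_polyDl ?size_scale ?invr_eq0 // size_polyX //.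
by apply: leq_ltn_trans (size_polyC_leq1 _) _.
Qed.

Lemma valid_linv d : valid d -> valid (linv d).
Proof. by case/andP => a0 c0; rewrite /valid /= !invr_eq0 a0. Qed.

Lemma tri_linvK d : valid d -> cancel (tri d) (tri (linv d)).
Proof.
move=> vd u; have := congr1 (fun e => tri e u) (linvlK vd).
by rewrite tri_lmul tri_one.
Qed.

Lemma tri_linvKr d : valid d -> cancel (tri (linv d)) (tri d).
Proof.
move=> vd u; have eK := tri_linvK (valid_linv vd).
by rewrite -[LHS]eK (tri_linvK vd) eK.
Qed.

End Tame.

(** * Jung's theorem *)

Section Jung.
Variable K : numFieldType.
Local Notation A := {mpoly K[2]}.
Local Notation x := ('X_ord0 : A).
Local Notation y := ('X_ord_max : A).

Fixpoint den (l : seq (letter K)) : {lrmorphism A -> A} :=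
  if l is d :: l' then (@swap K \o tri d \o den l' : {lrmorphism A -> A})
  else (idfun : {lrmorphism A -> A}).

Lemma den_cat l1 l2 : den (l1 ++ l2) =1 den l1 \o den l2.
Proof. by elim: l1 => [|d l1 IH] u; [|rewrite /= (IH u)]. Qed.

Lemma den_rcons l d : den (rcons l d) =1 den l \o @swap K \o tri d.
Proof. by move=> u; rewrite -cats1 den_cat. Qed.

(** The inverse of [swap t1 .. swap tn] is [tn^-1 swap .. t1^-1 swap], with the swaps on the other
    side; conjugation by [swap] restores the form of [den]. *)
Definition den_inv (l : seq (letter K)) : A -> A :=
  swap (K:=K) \o den (rev (map (@linv K) l)) \o swap (K:=K).
HB.instance Definition _ l := GRing.LRMorphism.on (den_inv l).

Lemma den_invK l : all (@valid K) l -> cancel (den l) (den_inv l).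
Proof.
elim: l => [|d l IH] /=; first by move=> _ u; rewrite /den_inv /= swapK.
case/andP => vd /IH lK u; rewrite /den_inv /= rev_cons den_rcons /=.
rewrite swapK tri_linvK //; exact: lK.
Qed.

Lemma den_invKr l : all (@valid K) l -> cancel (den_inv l) (den l).
Proof.
elim: l => [|d l IH] /=; first by move=> _ u; rewrite /den_inv /= swapK.
case/andP => vd /IH lK u; rewrite /den_inv /= rev_cons den_rcons /=.
have := lK (tri (linv d) (swap u)); rewrite /den_inv /= => ->.
by rewrite tri_linvKr // swapK.
Qed.

(** Letters may be trivial, which makes closure easy: a triangular factor on the right merges into
    the last letter, a swap appends a trivial one. *)
Definition tame (f : A -> A) := exists d l,
  [/\ valid d, all (@valid K) l & f = tri d \o den l].

Lemma tame_tri f d : valid d -> tame f -> tame (f \o tri d).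
Proof.
move=> vd [e [l [ve vl ->]]]; case/lastP: l vl => [_|l d' vl].
  exists (lmul e d), [::]; split; [exact: valid_lmul|by []|].
  by apply/funext => u /=; rewrite tri_lmul.
exists e, (rcons l (lmul d' d)); move: vl; rewrite !all_rcons => /andP[vd' vl].
split=> //; first by rewrite valid_lmul.
by apply/funext => u /=; rewrite !den_rcons /= tri_lmul.
Qed.

Lemma valid_lone : valid (lone K).
Proof. by rewrite /valid /= oner_eq0. Qed.

Lemma tame_swap f : tame f -> tame (f \o @swap K).
Proof.
move=> [e [l [ve vl ->]]]; exists e, (rcons l (lone K)); rewrite all_rcons valid_lone.
by split=> //; apply/funext => u /=; rewrite den_rcons /= tri_one.
Qed.

Definition shear (c : K) q := Letter 1 0 1 (- c *: 'X^q).

Lemma valid_shear c q : valid (shear c q).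
Proof. by rewrite /valid /= oner_eq0. Qed.

Lemma shearx c q : tri (shear c q) x = x.
Proof. by rewrite trix /= scale1r mpolyC0 addr0. Qed.

Lemma sheary c q : tri (shear c q) y = y - c *: x ^+ q.
Proof. by rewrite triy /= scale1r horner_algZ rmorphXn /= horner_algX scaleNr. Qed.

Lemma affine_form (h : A) : (msize h <= 2)%N ->
  h = h@_U_(ord0) *: x + h@_U_(ord_max) *: y + (h@_0)%:MP.
Proof.
move=> sh; apply/mpolyP => m; rewrite !mcoeffD !mcoeffZ mcoeffC !mcoeffX.
have [m2|] := leqP 2 (mdeg m).
  have nU i : (U_(i) == m)%MM = false by apply: contraTF m2 => /eqP <-; rewrite mdeg1.
  have n0 : (m == 0%MM) = false by apply: contraTF m2 => /eqP ->; rewrite mdeg0.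
  rewrite !nU n0 !mulr0 !addr0; apply: memN_msupp_eq0; apply: msize_mdeg_ge.
  exact: leq_trans sh m2.
rewrite ltnS leq_eqVlt ltnS leqn0 => /orP[/mdeg1P[i /eqP->]|]; last first.
  by rewrite mdeg_eq0 => /eqP->; rewrite eqxx !mnm1_eq0 !mulr0 mulr1 !add0r.
rewrite !eq_mnm1 mnm1_eq0 mulr0 addr0.
by case: (ord2P i) => ->; rewrite /= mulr1 mulr0 ?addr0 ?add0r.
Qed.

(** Gaussian elimination: if [f x] does not involve [y], then [f] is triangular; otherwise a linear
    shear removes [y] from [f y], and a swap leads back to that case. *)
Lemma tame_affine (f g : {lrmorphism A -> A}) : cancel f g ->
  total_degree (f x) = 1%N -> total_degree (f y) = 1%N -> tame f.
Proof.
move=> fK mx my.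
have form h : total_degree h = 1%N -> h = h@_U_(ord0) *: x + h@_U_(ord_max) *: y + (h@_0)%:MP.
  by move=> h1; apply: affine_form; move: h1; rewrite /total_degree;
    case: (msize h) => [|[|[]]].
have tri_of (k h : {lrmorphism A -> A}) : cancel k h -> total_degree (k y) = 1%N ->
    (exists a b, k x = a *: x + b%:MP) -> tame k.
  move=> kK ky [a [b kx]].
  have a0 : a != 0.
    apply/eqP => a0; have := total_deg_auto_gt0 kK (_ : 0 < total_degree x)%N.
    by rewrite total_degX kx a0 scale0r add0r total_degC => /(_ isT).
  have ey := form _ ky.
  (* Otherwise [k] would send the nonconstant [y - p x] to a constant. *)
  have c0 : (k y)@_U_(ord_max) != 0.
    apply/eqP => c0; rewrite c0 scale0r addr0 in ey.
    pose p := (a^-1 * (k y)@_U_(ord0)).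
    have pa : p * a = (k y)@_U_(ord0) by rewrite /p mulrAC mulVf // mul1r.
    have e : k (y - p *: x) = ((k y)@_0 - p * b)%:MP.
      rewrite linearB linearZ /= {1}ey kx scalerDr scalerA pa.
      by rewrite opprD addrACA subrr add0r mpolyCB mpolyCM mul_mpolyC.
    have := congr1 (mderiv ord_max \o h) e; rewrite /= kK lrmorphC mderivC.
    rewrite mderivB mderivZ !mderivXX /= scaler0 subr0.
    by apply/eqP; rewrite oner_eq0.
  exists (Letter a b ((k y)@_U_(ord_max)) ((k y)@_U_(ord0) *: 'X + ((k y)@_0)%:P)), [::].
  split=> //; first by rewrite /valid /= a0.
  apply: (@lrmorph_eq _ k (tri _ \o idfun)) => /=; rewrite ?trix ?triy //=.
  by rewrite horner_alg_lin {1}ey addrA [_ *: x + _]addrC.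
have fx := form _ mx; have fy := form _ my.
move: fx fy; set a := (f x)@_U_(ord0); set b := (f x)@_U_(ord_max).
set a' := (f y)@_U_(ord0); set b' := (f y)@_U_(ord_max) => fx fy.
have [b0|b0] := eqVneq b 0.
  by apply: (tri_of f g fK my); exists a, (f x)@_0; rewrite {1}fx b0 scale0r addr0.
pose e := shear (b' / b) 1; have ve : valid e := valid_shear _ _.
have : tame (f \o tri e \o @swap K).
  apply: (tri_of (f \o tri e \o @swap K) (@swap K \o tri (linv e) \o g)).
  - by move=> u /=; rewrite fK (tri_linvK ve) swapK.
  - by rewrite /= swapy shearx.
  exists (a' - b' / b * a), ((f y)@_0 - b' / b * (f x)@_0).
  rewrite /= swapx sheary expr1 linearB linearZ /= {1}fy {1}fx.
  rewrite !scalerDr !scalerA divfK // opprD addrACA mpolyCB mpolyCM mul_mpolyC.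
  by congr (_ + _); rewrite opprD addrACA subrr addr0 scalerBl.
move=> /tame_swap/(tame_tri (valid_linv ve)); congr tame; apply/funext => u /=.
by rewrite swapK tri_linvKr.
Qed.

(** Induction on the sum of the two degrees: the smaller divides the larger, the leading forms are
    proportional up to a power, and so a shear lowers the larger degree until both are 1. *)
Lemma jung (f g : {lrmorphism A -> A}) : cancel f g -> cancel g f -> tame f.
Proof.
have [N] := ubnP (total_degree (f x) + total_degree (f y)); elim: N f g => // N IH f g lt fK gK.
have key (k h : {lrmorphism A -> A}) : (total_degree (k x) + total_degree (k y) < N.+1)%N ->
    cancel k h -> cancel h k -> (total_degree (k x) <= total_degree (k y))%N -> tame k.
  move=> ltk kK hK le.
  have /dvdnP[q en] := auto_deg_dvd kK hK le.
  have m0 : (0 < total_degree (k x))%N by apply: total_deg_auto_gt0 kK _; rewrite total_degX.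
  have n0 : (0 < total_degree (k y))%N by apply: total_deg_auto_gt0 kK _; rewrite total_degX.
  have q0 : (0 < q)%N by move: n0; rewrite en; case: (q).
  have [le2|lt2] := leqP (total_degree (k x) + total_degree (k y)) 2.
    by apply: (tame_affine kK); move: m0 n0 le2; clear; lia.
  have [c c0 jk] := jacobian_auto hK; rewrite mulnC in en.
  have [d dlt] := leading_form_power jk m0 en lt2 q0.
  pose e := shear d q; have ve : valid e := valid_shear _ _.
  have : tame (k \o tri e).
    apply: (IH (k \o tri e) (tri (linv e) \o h)).
    - rewrite /= shearx sheary linearB linearZ rmorphXn /=.
      by move: n0 ltk dlt; rewrite /total_degree; move: (msize _) (msize _) (msize _); clear;
        lia.
    - by move=> u /=; rewrite kK (tri_linvK ve).
    - by move=> u /=; rewrite (tri_linvKr ve) hK.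
  move=> /(tame_tri (valid_linv ve)); congr tame; apply/funext => u /=.
  by rewrite tri_linvKr.
have [le|gt] := leqP (total_degree (f x)) (total_degree (f y)); first exact: key lt fK gK le.
have : tame (f \o @swap K).
  apply: (key (f \o @swap K) (@swap K \o g)).
  - by rewrite /= swapx swapy addnC.
  - by move=> u /=; rewrite fK swapK.
  - by move=> u /=; rewrite swapK gK.
  by rewrite /= swapx swapy ltnW.
by move=> /tame_swap; congr tame; apply/funext => u /=; rewrite swapK.
Qed.
End Jung.

(** * Degree growth of words and conjugation to reduced form *)

Section NormalForm.
Variable K : numFieldType.
Local Notation A := {mpoly K[2]}.
Local Notation x := ('X_ord0 : A).
Local Notation y := ('X_ord_max : A).

Lemma msizeDl (u v : A) : (msize v < msize u)%N -> msize (u + v) = msize u.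
Proof.
move=> lt; apply/eqP; rewrite eqn_leq; apply/andP; split.
  by rewrite (leq_trans (mmeasureD_le _ _ _)) // geq_max leqnn ltnW.
have := mmeasureD_le mdeg (u + v) (- v); rewrite addrK mmeasureN leq_max.
by case/orP => // /(leq_trans lt); rewrite ltnn.
Qed.

Lemma msizeC_le1 c : (msize (c%:MP : A) <= 1)%N.
Proof. by rewrite mmeasureC; case: (_ != _). Qed.

Lemma msize_horner (u : A) p : (1 < msize u)%N -> p != 0 ->
  msize (horner_alg u p) = ((size p).-1 * (msize u).-1).+1.
Proof.
move=> u1; elim/poly_ind: p => [|p c IH]; first by rewrite eqxx.
have u0 : u != 0 by rewrite -(mmeasure_poly_eq0 mdeg) -lt0n ltnW.
have eh : horner_alg u (p * 'X + c%:P) = horner_alg u p * u + c%:MP.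
  by rewrite rmorphD rmorphM /= horner_algX horner_algMC.
have [->|p0] := eqVneq p 0 => nz.
  move: nz; rewrite mul0r add0r horner_algMC polyC_eq0 => c0.
  by rewrite mmeasureC c0 size_polyC c0.
have sp : (0 < size p)%N by rewrite size_poly_gt0.
have sM : msize (horner_alg u p * u) = (size p * (msize u).-1).+1.
  rewrite msizeM ?IH //; last by rewrite -(mmeasure_poly_eq0 mdeg) IH.
  by move: sp u1; case: (size p) => // s; case: (msize u) => // m _ _; rewrite mulSn /=; lia.
rewrite eh size_MXaddC (negPf p0) /= msizeDl sM // ltnS (leq_trans (msizeC_le1 c)) //.
by rewrite muln_gt0 sp; move: u1; case: (msize u) => [|[]].
Qed.

Lemma msize_affine (u : A) a b : (1 < msize u)%N -> a != 0 ->
  msize (a *: u + b%:MP) = msize u.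
Proof. by move=> u1 a0; rewrite msizeDl msizeZ // (leq_ltn_trans (msizeC_le1 b)). Qed.

Lemma msize_tri_y (u v : A) c (p : {poly K}) :
  (1 < msize u)%N -> (msize v <= msize u)%N -> (2 < size p)%N ->
  msize (c *: v + horner_alg u p) = ((size p).-1 * (msize u).-1).+1.
Proof.
move=> u1 vu p2; have p0 : p != 0 by rewrite -size_poly_gt0 (leq_trans _ p2).
rewrite addrC msizeDl msize_horner // ltnS (leq_trans (msizeZ_le _ _)) // (leq_trans vu) //.
by move: u1 p2; case: (msize u) => [|[|m]] //; case: (size p) => [|[|[|s]]] // _ _ /=; nia.
Qed.

(** Appending a letter makes the new image of [x] affine in the old image of [y], and the new image
    of [y] dominated by [lpol] of the old one, which at least doubles its degree. *)
Lemma strict_growth (l : seq (letter K)) : all (@strict K) l ->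
  [/\ (1 < msize (den l x))%N, (msize (den l x) <= msize (den l y))%N,
      (2 ^ size l < msize (den l y))%N
    & (0 < size l)%N -> (2 * total_degree (den l x) <= total_degree (den l y))%N].
Proof.
elim/last_ind: l => [|l d IH].
  by move=> _; rewrite /= !msizeX !mdeg1.
rewrite all_rcons => /andP[/andP[/andP[a0 c0] sp] /IH[sx xy sz _]].
have ex : den (rcons l d) x = lx d *: den l y + (lx0 d)%:MP.
  by rewrite den_rcons /= trix !linearD !linearZ /= swapx !lrmorphC.
have ey : den (rcons l d) y = ly d *: den l x + horner_alg (den l y) (lpol d).
  by rewrite den_rcons /= triy !linearD !linearZ /= swapy !lrmorph_horner /= swapx.
have sy : (1 < msize (den l y))%N by apply: leq_trans xy.
rewrite /total_degree ex ey msize_affine // msize_tri_y // size_rcons.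
move: sy sz sp; rewrite expnS; case: (msize (den l y)) => [|[|m]] //.
by case: (size (lpol d)) => [|[|[|s]]] // _ sz _; rewrite /= ; split=> // [||_]; nia.
Qed.

Definition conjugate (f h : A -> A) := exists p p' : {lrmorphism A -> A},
  [/\ cancel p p', cancel p' p & f = p \o h \o p'].

Lemma conjugate_refl f : conjugate f f.
Proof. by exists idfun, idfun. Qed.

Lemma conjugate_trans f g h : conjugate f g -> conjugate g h -> conjugate f h.
Proof.
move=> [p [p' [pK pK' ->]]] [q [q' [qK qK' ->]]].
exists (p \o q), (q' \o p'); split=> // u /=; first by rewrite pK qK.
by rewrite qK' pK'.
Qed.

Definition bounded_degree (f : A -> A) := exists C, forall n i, (msize (iter n f 'X_i) <= C)%N.

(** The iterates are again letters, and their polynomials do not grow in degree, since they are only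
    composed with affine polynomials in [x]. *)
Lemma bounded_tri d : valid d -> bounded_degree (tri d).
Proof.
move=> vd; exists (maxn 2 (size (lpol d)).+1) => n i.
have [e [ve se ->]] : exists e, [/\ valid e, (size (lpol e) <= size (lpol d))%N
    & iter n (tri d) =1 tri e].
  elim: n => [|n [e [ve se en]]].
    by exists (lone K); split; [exact: valid_lone| rewrite size_poly0|move=> u;
      rewrite tri_one].
  exists (lmul d e); split; first exact: valid_lmul.
    rewrite (leq_trans (size_polyD _ _)) // geq_max (leq_trans (size_scale_leq _ _)) //=.
    rewrite size_comp_poly2 //; case/andP: vd => a0 _.
    rewrite size_polyDl ?size_scale ?size_polyX //.
    exact: leq_ltn_trans (size_polyC_leq1 _) _.
  by move=> u; rewrite iterS en tri_lmul.
have x1 : msize x = 2 by rewrite msizeX mdeg1.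
have y1 : msize y = 2 by rewrite msizeX mdeg1.
case: (ord2P i) => ->.
  rewrite trix leq_max msize_affine ?x1 //; by case/andP: ve.
rewrite triy (leq_trans (mmeasureD_le _ _ _)) // geq_max (leq_trans (msizeZ_le _ _)) ?y1
  ?leq_maxl //=.
have [->|p0] := eqVneq (lpol e) 0; first by rewrite rmorph0 mmeasure0.
by rewrite msize_horner ?x1 // muln1 prednK ?size_poly_gt0 // leq_max (leqW se) orbT.
Qed.

Lemma bounded_affine (f : {lrmorphism A -> A}) :
  (msize (f x) <= 2)%N -> (msize (f y) <= 2)%N -> bounded_degree f.
Proof.
move=> sx sy; exists 2%N => n i; elim: n => [|n IH]; first by rewrite msizeX mdeg1.
rewrite iterS (affine_form IH) !linearD !linearZ /= lrmorphC.
rewrite (leq_trans (mmeasureD_le _ _ _)) // geq_max (leq_trans (msizeC_le1 _)) // andbT.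
rewrite (leq_trans (mmeasureD_le _ _ _)) // geq_max.
by rewrite !(leq_trans (msizeZ_le _ _)).
Qed.

Definition reduced (f : A -> A) :=
  bounded_degree f \/ exists l, [/\ (0 < size l)%N, all (@strict K) l & f = den l].

Lemma all_split (T : Type) (P : pred T) l : ~~ all P l ->
  exists l1 d l2, ~~ P d /\ l = l1 ++ d :: l2.
Proof.
elim: l => //= d l IH; have [Pd /= /IH [l1 [e [l2 [ne ->]]]]|nPd _] := boolP (P d).
  by exists (d :: l1), e, l2.
by exists [::], d, l.
Qed.

Lemma lrmorph_affine (f : {lrmorphism A -> A}) a b c u v :
  f (a *: u + (b *: v + c%:MP)) = a *: f u + (b *: f v + c%:MP).
Proof. by rewrite !linearD !linearZ /= lrmorphC. Qed.

(** The conjugate is affine, and the coefficient of [y] in its image of [x], the linear coefficient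
    of [lpol d], decides its Bruhat cell. *)
Lemma swap_affine (d : letter K) : valid d -> (size (lpol d) <= 2)%N ->
  (exists2 e, valid e & swap (K:=K) \o tri d \o swap (K:=K) = tri e) \/
  (exists e e', [/\ valid e, valid e' &
     swap (K:=K) \o tri d \o swap (K:=K) = tri e \o swap (K:=K) \o tri e']).
Proof.
case: d => a b c p /andP[/= a0 c0] sp.
have ep : p = p`_1 *: 'X + (p`_0)%:P.
  apply/polyP => i; rewrite coefD coefZ coefX coefC; case: i => [|[|i]] /=.
  - by rewrite mulr0 add0r.
  - by rewrite mulr1 addr0.
  by rewrite mulr0 addr0 nth_default // (leq_trans sp).
have hx : swap (tri (Letter a b c p) (swap x)) = c *: x + p`_1 *: y + (p`_0)%:MP.
  rewrite /= swapx triy /= {1}ep horner_alg_lin !linearD !linearZ /= swapx swapy lrmorphC.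
  by rewrite addrA.
have hy : swap (tri (Letter a b c p) (swap y)) = a *: y + b%:MP.
  by rewrite /= swapy trix !linearD !linearZ /= swapx lrmorphC.
move: hx hy; set p1 := p`_1; set p0 := p`_0 => hx hy.
have [p1z|p1n] := eqVneq p1 0.
  left; exists (Letter c p0 a b%:P); first by rewrite /valid /= c0.
  apply: (@lrmorph_eq _ (swap (K:=K) \o tri (Letter a b c p) \o swap (K:=K)) (tri _)).
    by rewrite /= hx trix p1z scale0r addr0.
  by rewrite /= hy triy /= horner_algMC.
(* The coefficients solve [a y + b = a/p1 (c x + p1 y + p0) - a c/p1 x + (b - a/p1 p0)]. *)
right; exists (Letter 1 0 p1 (c *: 'X + p0%:P)).
exists (Letter 1 0 (- (a * c / p1)) ((a / p1) *: 'X + (b - a / p1 * p0)%:P)); split.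
- by rewrite /valid /= oner_eq0.
- by rewrite /valid /= oner_eq0 oppr_eq0 !mulf_neq0 ?invr_eq0.
apply: (@lrmorph_eq _ (swap (K:=K) \o tri (Letter a b c p) \o swap (K:=K))
   (tri _ \o swap (K:=K) \o tri _)).
  rewrite /= hx trix /= scale1r !linearD /= !lrmorphC swapx triy /= horner_alg_lin.
  by rewrite mpolyC0 addr0 addrA [p1 *: _ + _]addrC.
rewrite /= hy triy /= horner_alg_lin (lrmorph_affine (@swap K)) /= swapx swapy.
rewrite (lrmorph_affine (tri _)) /= trix triy /= horner_alg_lin scale1r mpolyC0 addr0.
rewrite !scalerDr !scalerA divfK // mpolyCB mpolyCM mul_mpolyC.
have E (V : zmodType) (X Y P B : V) : Y + B = - X + (Y + (X + P) + (B - P)).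
  by rewrite (addrA Y X P) addrACA subrr addr0 [Y + X]addrC -addrA addKr.
by rewrite scaleNr [a / p1 * c]mulrAC -E.
Qed.

(* An affine letter [a] can be conjugated to the front of the word, where
   [swap a swap] is affine and contains at most one [swap] by the Bruhat
   decomposition, so that the word gets shorter. *)
Lemma word_reduced (d : letter K) l : valid d -> all (@valid K) l ->
  exists2 f, reduced f & conjugate (tri d \o den l) f.
Proof.
have [N] := ubnP (size l); elim: N d l => // N IH d l szl vd vl.
case/lastP: l vl szl => [_ _|l e].
  by exists (tri d); [left; apply: bounded_tri | exact: conjugate_refl].
rewrite all_rcons size_rcons => /andP[ve vl] szl.
(* Conjugation by [tri d] moves that factor to the end of the word, where it merges into the last
   letter. *)
pose m := rcons l (lmul e d).
have em0 : m = rcons l (lmul e d) by [].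
have vm : all (@valid K) m by rewrite all_rcons valid_lmul.
have szm : size m = (size l).+1 by rewrite size_rcons.
suff [f rf cf] : exists2 f, reduced f & conjugate (den m) f.
  exists f => //; apply: conjugate_trans cf; exists (tri d), (tri (linv d)).
  split; [exact: tri_linvK|exact: tri_linvKr|apply/funext => u /=].
  by rewrite em0 !den_rcons /= tri_lmul /= tri_linvKr.
have [sm|/all_split [l1 [a [l2 [na em]]]]] := boolP (all (@strict K) m).
  by exists (den m); [right; exists m; split=> //; rewrite szm | exact: conjugate_refl].
clear em0; clearbody m; subst m; move: vm szm;
  rewrite all_cat size_cat /= => /and3P[vl1 va vl2] szm.
have sa : (size (lpol a) <= 2)%N by move: na; rewrite /strict va /= -leqNgt.
suff [f rf cf] : exists2 f, reduced f & conjugate (den (a :: l2 ++ l1)) f.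
  exists f => //; apply: conjugate_trans cf; exists (den l1), (den_inv l1).
  split; [exact: den_invK|exact: den_invKr|apply/funext => u /=].
  by rewrite !den_cat /= den_invKr.
have vl' : all (@valid K) (l2 ++ l1) by rewrite all_cat vl2.
have szl' : (size (l2 ++ l1) < N)%N.
  by rewrite size_cat; move: szm szl; clear; lia.
case: (l2 ++ l1) vl' szl' => [_ _|e' l' /= /andP[ve' vl'] szl'].
  exists (den [:: a]); last exact: conjugate_refl.
  left; apply: bounded_affine.
    rewrite /= trix linearD linearZ /= swapx lrmorphC msize_affine ?msizeX ?mdeg1 //.
    by case/andP: va.
  rewrite /= triy linearD linearZ /= swapy lrmorph_horner /= swapx.
  rewrite (leq_trans (mmeasureD_le _ _ _)) // geq_max (leq_trans (msizeZ_le _ _)) ?msizeX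
    ?mdeg1 //=.
  have [->|p0] := eqVneq (lpol a) 0; first by rewrite rmorph0 mmeasure0.
  by rewrite msize_horner ?msizeX ?mdeg1 // muln1 prednK ?size_poly_gt0.
have wordE : den [:: a, e' & l'] =
    (swap (K:=K) \o tri a \o swap (K:=K)) \o (tri e' \o den l') :> (A -> A) by [].
have [[b vb eb]|[b [b' [vb vb' eb]]]] := swap_affine va sa.
  have [f rf cf] := IH (lmul b e') l' (ltnW szl') (valid_lmul vb ve') vl'.
  exists f; first by [].
  by rewrite wordE eb; move: cf; rewrite tri_lmul.
have vl2' : all (@valid K) (lmul b' e' :: l') by rewrite /= valid_lmul.
have [f rf cf] := IH b (lmul b' e' :: l') szl' vb vl2'.
exists f; first by [].
have wordE2 : tri b \o den (lmul b' e' :: l') =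
    (tri b \o swap (K:=K) \o tri b') \o (tri e' \o den l') :> (A -> A).
  by apply/funext => u /=; rewrite tri_lmul.
by rewrite wordE eb -wordE2.
Qed.
End NormalForm.

(** * Derivations commuting with a reduced word *)

Section LocallyFinite.
Variable K : numFieldType.
Local Notation A := {mpoly K[2]}.
Local Notation x := ('X_ord0 : A).
Local Notation y := ('X_ord_max : A).

Lemma derivationC (D : {linear A -> A}) c : is_derivation D -> D c%:MP = 0.
Proof.
move=> dD; have D1 : D 1 = 0.
  by have := dD 1 1; rewrite !mulr1 mul1r -[X in X = _]addr0 => /addrI.
by rewrite -[c%:MP]mulr1 mul_mpolyC linearZ /= D1 scaler0.
Qed.

Lemma partial_deg_le i (h : A) N :
  (forall u, u \in msupp h -> (u i <= N)%N) -> (partial_deg i h <= N)%N.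
Proof. by move=> hN; apply/bigmax_leqP_seq => u uh _; apply: hN. Qed.

Lemma leq_partial_deg i (h : A) u : u \in msupp h -> (u i <= partial_deg i h)%N.
Proof. by move=> uh; rewrite /partial_deg (bigD1_seq u) ?msupp_uniq //= leq_maxl. Qed.

Lemma lrmorph_sum (f : {lrmorphism A -> A}) h :
  f h = \sum_(v <- msupp h) h@_v *: f 'X_[v].
Proof. by rewrite {1}[h]mpolyE linear_sum; apply: eq_bigr => v _; rewrite linearZ. Qed.

Lemma partial_deg_swap_le i (h : A) :
  (partial_deg i (swap h) <= partial_deg (rev_ord i) h)%N.
Proof.
apply: partial_deg_le => u; rewrite mcoeff_msupp => nz.
suff [v vh <-] : exists2 v, v \in msupp h & v (rev_ord i) = u i by apply: leq_partial_deg.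
have /hasP[v vh /eqP ev] : has (fun v : 'X_{1..2} => [multinom v (rev_ord j) | j < 2] == u)
  (msupp h).
  apply: contraNT nz => /hasPn no; rewrite lrmorph_sum raddf_sum /= big_seq big1 // => v vh.
  rewrite mcoeffZ [swap _](_ : _ = 'X_[[multinom v (rev_ord j) | j < 2]]).
    by rewrite mcoeffX (negPf (no v vh)) mulr0.
  rewrite !mpolyXE_id rmorph_prod /= !big_ord_recl !big_ord0 !mulr1 !rmorphXn /= !mnmE.
  have -> : lift ord0 ord0 = ord_max :> 'I_2 by apply: val_inj.
  have -> : rev_ord ord0 = ord_max :> 'I_2 by apply: val_inj.
  have -> : rev_ord ord_max = ord0 :> 'I_2 by apply: val_inj.
  by rewrite swapx swapy mulrC.
by exists v => //; rewrite -ev mnmE.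
Qed.

Lemma partial_deg_swap i (h : A) : partial_deg i (swap h) = partial_deg (rev_ord i) h.
Proof.
apply/eqP; rewrite eqn_leq partial_deg_swap_le.
by have := partial_deg_swap_le (rev_ord i) (swap h); rewrite swapK rev_ordK.
Qed.

Lemma msize_mderiv i (h : A) : (msize h^`M(i) <= msize h)%N.
Proof.
rewrite msizeE; apply/bigmax_leqP_seq => u; rewrite mcoeff_msupp mcoeff_mderiv => nz _.
have uh : (u + U_(i))%MM \in msupp h.
  by rewrite mcoeff_msupp; apply: contraNneq nz => ->; rewrite mul0rn.
by apply: ltn_trans (msize_mdeg_lt uh); rewrite mdegD mdeg1 addn1.
Qed.

Lemma derivation_degree (D : {linear A -> A}) : is_derivation D ->
  exists e, forall h, (msize (D h) <= msize h + e)%N.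
Proof.
move=> dD; exists (maxn (msize (D x)) (msize (D y))).+1 => h.
rewrite (@derivation_chain K _ idfun D); last first.
- by move=> u v; rewrite dD.
- by move=> u v; rewrite linearD.
- by move=> c; rewrite derivationC.
rewrite (leq_trans (mmeasureD_le _ _ _)) // geq_max.
by apply/andP; split; apply: leq_trans (msizeM_le _ _) _;
  rewrite addnS ltnS leq_add ?msize_mderiv ?leq_maxl ?leq_maxr.
Qed.

Lemma den_flatten n l : den (flatten (nseq n l)) =1 iter n (den l) :> (A -> A).
Proof. by elim: n => [|n IH] u //; rewrite /= den_cat /= IH. Qed.

(* A large power [den m] of [den l] maps [D^j x_i] to [D^j (den m x_i)], whose
   degree exceeds that of [den m x_i] by a bounded amount only. *)
Lemma orbit_bound (D : {linear A -> A}) l i j : is_derivation D -> (0 < size l)%N ->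
  all (@strict K) l -> (forall u, D (den l u) = den l (D u)) ->
  (4 * partial_deg ord_max (iter j D 'X_i) <= 8 + 3 * partial_deg ord0 (iter j D 'X_i))%N.
Proof.
move=> dD sl stl Dl; have [e De] := derivation_degree dD.
set h := iter j D 'X_i; have [->|h0] := eqVneq h 0.
  by rewrite /partial_deg msupp0 big_nil.
(* As [2^k > j e], the degree of [den m y] is at least the gain [j e] of [D^j]. So [den m h] has at
   most twice the degree of [den m y], and 8 is 4 times 2. *)
pose k := (j * e).+1; pose m := flatten (nseq k l).
have stm : all (@strict K) m by rewrite /m; elim: (k) => //= r IH; rewrite all_cat stl.
have szm : (k <= size m)%N.
  by rewrite size_flatten /shape map_nseq sumn_nseq leq_pmull.
have [sx xy sz /(_ _) gr] := strict_growth stm.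
have {}gr := gr (leq_trans (ltn0Sn _) szm).
have vm : all (@valid K) m by apply: sub_all stm => d /andP[].
have [c c0 jm] := jacobian_auto (den_invKr vm).
have m0 : (0 < total_degree (den m x))%N by rewrite /total_degree; move: sx;
  case: (msize _) => [|[]].
have := deg_comp_ge c0 jm m0 gr h0.
have eh : den m h = iter j D (den m 'X_i).
  rewrite /h; elim: (j) => //= j' IH; rewrite -IH.
  have Dm u n : D (iter n (den l) u) = iter n (den l) (D u).
    by elim: n => //= n <-; rewrite Dl.
  by rewrite !den_flatten -Dm.
have bh : (msize (den m h) <= msize (den m y) + j * e)%N.
  rewrite eh; elim: (j) => [|j' IH] /=.
    by rewrite mul0n addn0; case: (ord2P i) => ->.
  by rewrite (leq_trans (De _)) // mulSn [(e + _)%N]addnC addnA leq_add2r.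
have n0 : (0 < total_degree (den m y))%N by apply: leq_trans m0 _;
  rewrite /total_degree -!subn1 leq_sub2r.
have jn : (j * e <= total_degree (den m y))%N.
  have : (k < msize (den m y))%N by apply: leq_ltn_trans szm (ltn_trans (ltn_expl _ _) sz).
  by rewrite /k /total_degree; case: (msize _) => // r; rewrite ltnS => /ltnW.
have : (total_degree (den m h) <= 2 * total_degree (den m y))%N.
  by move: bh jn n0; rewrite /total_degree; move: (msize _) (msize _) (j * e)%N; clear; lia.
move=> t2 est; rewrite -(leq_pmul2l n0) mulnDr !(mulnCA (total_degree (den m y))).
by move: t2 est; clear; lia.
Qed.

End LocallyFinite.

(** * Local finiteness *)

Section Simple.
Variable K : numClosedFieldType.
Local Notation A := {mpoly K[2]}.
Local Notation x := ('X_ord0 : A).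
Local Notation y := ('X_ord_max : A).

(** The word [l'] is the inverse of [den l] conjugated by [swap], and it commutes with the conjugate
    [D']. For the partial degrees p and q, [4 q <= 8 + 3 p] and [4 p <= 8 + 3 q] even give 8; any
    constant would do. *)
Lemma orbit_partial_deg (D : {linear A -> A}) (l : seq (letter K)) i j k : is_derivation D ->
  (0 < size l)%N -> all (@strict K) l -> (forall u, D (den l u) = den l (D u)) ->
  (partial_deg k (iter j D 'X_i) <= 16)%N.
Proof.
move=> dD sl stl Dl.
have vl : all (@valid K) l by apply: sub_all stl => d /andP[].
pose D' : {linear A -> A} := @swap K \o D \o @swap K.
pose l' := rev (map (@linv K) l).
have dD' : is_derivation D'.
  by move=> u v; rewrite /= rmorphM dD rmorphD !rmorphM /= !swapK.
have stl' : all (@strict K) l'.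
  by rewrite /l' all_rev all_map; apply: sub_all stl => d; apply: strict_linv.
have sl' : (0 < size l')%N by rewrite size_rev size_map.
have Dinv u : D (den_inv l u) = den_inv l (D u).
  by rewrite -[LHS](den_invK vl) -Dl den_invKr.
have Dl' u : D' (den l' u) = den l' (D' u).
  have := Dinv (swap u); rewrite /den_inv /= -/l' swapK => e.
  by rewrite e swapK.
have iterD' n u : iter n D' u = swap (iter n D (swap u)).
  by elim: n => [|n IH] /=; rewrite ?swapK // IH swapK.
have b1 := orbit_bound i j dD sl stl Dl.
have b2 := orbit_bound (rev_ord i) j dD' sl' stl' Dl'.
have r0 : rev_ord ord0 = ord_max :> 'I_2 by apply: val_inj.
have r1 : rev_ord ord_max = ord0 :> 'I_2 by apply: val_inj.
have sX (r : 'I_2) : swap ('X_(rev_ord r) : A) = 'X_r.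
  by case: (ord2P r) => ->; rewrite (r0, r1) (swapx, swapy).
move: b2; rewrite iterD' sX !partial_deg_swap r0 r1.
by case: (ord2P k) b1 => ->; clear; move: (partial_deg ord0 _) (partial_deg ord_max _); lia.
Qed.

(** There are only [(N+1)^2] monomials available for [(N+1)^2 + 1] elements. The dependency is
    packed into a polynomial so that for [h j = D^j u] it reads [c(D) u = 0]. *)
Lemma bounded_family_dep (h : nat -> A) N : (forall j k, partial_deg k (h j) <= N)%N ->
  exists2 c : {poly K}, c != 0 & \sum_(j < size c) c`_j *: h j = 0.
Proof.
move=> hN; pose r := (N.+1 * N.+1).+1.
pose mon (a b : 'I_N.+1) : 'X_{1..2} := [multinom (if i == ord0 then a : nat else b) | i < 2].
pose M : 'M[K]_(r, N.+1 * N.+1) := \matrix_(j < r) mxvec (\matrix_(a, b) (h j)@_(mon a b)).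
have kerM : kermx M != 0.
  by rewrite kermx_eq0 /row_free ltn_eqF // ltnS rank_leq_col.
pose v := nz_row (kermx M).
have v0 : v != 0 by rewrite nz_row_eq0.
have vM : v *m M = 0 by apply/sub_kermxP; apply: nz_row_sub.
exists (rVpoly v); first by rewrite raddf_eq0 //; apply: can_inj (@rVpolyK _ _).
have -> : \sum_(j < size (rVpoly v)) (rVpoly v)`_j *: h j = \sum_(j < r) v 0 j *: h j.
  have sv : (size (rVpoly v) <= r)%N by apply: size_poly.
  rewrite (big_ord_widen r (fun j => (rVpoly v)`_j *: h j) sv) big_mkcond /=.
  apply: eq_bigr => j _; rewrite -coef_rVpoly_ord; case: ltnP => // le.
  by rewrite nth_default // scale0r.
apply/mpolyP => u; rewrite raddf_sum mcoeff0 /=.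
have [/andP[u0 u1]|] := boolP ((u ord0 < N.+1) && (u ord_max < N.+1))%N.
  have e : vec_mx (v *m M) (Ordinal u0) (Ordinal u1) = 0 by rewrite vM linear0 mxE.
  apply: etrans e; rewrite mulmx_sum_row linear_sum /= summxE.
  apply: eq_bigr => j _; rewrite rowK mcoeffZ [vec_mx _]linearZ /= mxvecK !mxE;
    congr (_ * _@__).
  by apply/mnmP => i; rewrite mnmE; case: (ord2P i) => ->.
move=> big; apply: big1 => j _; rewrite mcoeffZ (_ : (h j)@_u = 0) ?mulr0 //.
apply: memN_msupp_eq0; apply: contraNN big => uh.
by rewrite !ltnS !(leq_trans (leq_partial_deg _ uh)).
Qed.
End Simple.

Lemma derivation_horner (K : numFieldType) (E : {mpoly K[2]} -> {mpoly K[2]}) s p :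
  (forall c, E c%:MP = 0) -> {morph E : u v / u + v} ->
  (forall u v, E (u * v) = E u * v + u * E v) ->
  E (horner_alg s p) = horner_alg s p^`() * E s.
Proof.
move=> EC ED EM; elim/poly_ind: p => [|p c IH].
  by rewrite deriv0 !rmorph0 mul0r -(mpolyC0 2 K) EC.
rewrite derivD derivM derivX derivC addr0 mulr1 !rmorphD !rmorphM /= !horner_algX horner_algMC.
rewrite ED EM EC addr0 IH mulrDl; congr (_ + _).
by rewrite mulrAC.
Qed.

Lemma antiderivative (K : numFieldType) (p : {poly K}) : exists q, q^`() = p.
Proof.
exists (\poly_(i < (size p).+1) (p`_i.-1 / i%:R)); apply/polyP => i.
rewrite coef_deriv coef_poly ltnS /=; case: ltnP => [_|le].
  by rewrite -[LHS]mulr_natr divfK // pnatr_eq0.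
by rewrite mul0rn nth_default.
Qed.

(** * Simple derivations are not locally finite *)

Section NotLocallyFinite.
Variable K : numClosedFieldType.
Local Notation A := {mpoly K[2]}.
Local Notation x := ('X_ord0 : A).
Local Notation y := ('X_ord_max : A).
Variable D : {linear A -> A}.

(** The operator [c(D)] applied to [u]. *)
Definition act (c : {poly K}) (u : A) : A := \sum_(j < size c) c`_j *: iter j D u.

Lemma act_widen N (c : {poly K}) u : (size c <= N)%N -> act c u = \sum_(j < N) c`_j *: iter j
  D u.
Proof.
move=> le; rewrite /act (big_ord_widen N (fun j => c`_j *: iter j D u) le) big_mkcond /=.
by apply: eq_bigr => j _; case: ltnP => // le'; rewrite nth_default // scale0r.
Qed.

Lemma iterB n u v : iter n D (u - v) = iter n D u - iter n D v.
Proof. by elim: n => //= n ->; rewrite linearB. Qed.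

Lemma iterZ n a u : iter n D (a *: u) = a *: iter n D u.
Proof. by elim: n => //= n ->; rewrite linearZ. Qed.

Lemma actZ a (c : {poly K}) u : act (a *: c) u = a *: act c u.
Proof.
rewrite (@act_widen (size c)) ?size_scale_leq // /act scaler_sumr.
by apply: eq_bigr => j _; rewrite coefZ scalerA.
Qed.

Lemma act_mulXsubC (c : {poly K}) a u : act (('X - a%:P) * c) u = act c (D u - a *: u).
Proof.
rewrite (@act_widen (size c).+1); last first.
  rewrite (leq_trans (size_polyMleq _ _)) // size_XsubC //.
rewrite mulrBl (eq_bigr (fun j : 'I_(size c).+1 =>
   ('X * c)`_j *: iter j D u - a *: (c`_j *: iter j D u))) => [|j _]; last first.
  by rewrite coefB coefCM scalerBl scalerA.
rewrite sumrB -scaler_sumr -(@act_widen (size c).+1 c) // big_ord_recl coefXM scale0r add0r.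
rewrite /act scaler_sumr -sumrB; apply: eq_bigr => j _.
by rewrite coefXM /= iterB iterZ scalerBr -iterSr scalerA mulrC -scalerA.
Qed.

Hypothesis simpleD : simple_derivation D.

(** The principal ideal of an eigenvector is stable under [D], so the eigenvector is zero or a
    unit. *)
Lemma simple_eigen u a : D u = a *: u -> exists c, u = c%:MP.
Proof.
move=> Du; have [dD simp] := simpleD.
have [||I0|IT] := simp [set v | exists w, v = u * w]%classic.
- split; first by exists 0; rewrite mulr0.
    by move=> _ _ [w ->] [w' ->]; exists (w + w'); rewrite mulrDr.
  by move=> h _ [w ->]; exists (h * w); rewrite mulrCA.
- move=> _ [_ [w ->] <-]; exists (a *: w + D w).
  by rewrite dD Du mulrDr -scalerAl -scalerAr.
- have : [set v | exists w, v = u * w]%classic u by exists 1; rewrite mulr1.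
  by rewrite I0 /= => ->; exists 0; rewrite mpolyC0.
have : [set v | exists w, v = u * w]%classic 1 by rewrite IT.
by move=> /= [w /esym/mpoly_unitP[c _ ->]]; exists c.
Qed.

Lemma simple_ker u : D u = 0 -> exists c, u = c%:MP.
Proof. by move=> Du; apply: (@simple_eigen u 0); rewrite scale0r. Qed.

(** Over an algebraically closed field [c(D)] splits into factors [D - a]. If [D^r] kills
    [(D - a) u], then [D^r u] is an eigenvector, hence a constant, and [D^(r+1) u = 0]. *)
Lemma act_nilpotent (c : {poly K}) u : c != 0 -> act c u = 0 -> exists r, iter r D u = 0.
Proof.
have [dD _] := simpleD.
have [s ->] := closed_field_poly_normal c; rewrite scaler_eq0 negb_or => /andP[lc _].
rewrite actZ => /eqP; rewrite scaler_eq0 (negPf lc) /= => /eqP.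
elim: s u => [|a s IH] u.
  rewrite big_nil /act size_poly1 big_ord_recl big_ord0 coefC scale1r addr0 /= => ->.
  by exists 0%N.
rewrite big_cons act_mulXsubC => /IH[r er]; exists r.+1; move: er.
rewrite iterB iterZ -iterSr => /eqP; rewrite subr_eq0 => /eqP Dv.
have [b eb] := simple_eigen Dv; exact: etrans (congr1 D eb) (derivationC b dD).
Qed.

Lemma mpolyX_nonconst (i : 'I_2) c : 'X_i <> c%:MP :> A.
Proof. by move=> /(congr1 (@total_degree K)); rewrite total_degX total_degC. Qed.

Lemma simple_not_nilpotent r1 r2 : iter r1 D x = 0 -> iter r2 D y = 0 -> False.
Proof.
move=> n1 n2; have [dD _] := simpleD.
have ex : exists r, iter r D x == 0 by exists r1; apply/eqP.
case: (ex_minnP ex) => [[|[|r]]] /eqP /= er rmin.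
- by case: (@mpolyX_nonconst ord0 0); rewrite mpolyC0.
- by have [c ec] := simple_ker er; case: (@mpolyX_nonconst ord0 c).
have [c ec] := simple_ker er.
have c0 : c != 0.
  apply/eqP => c0; have := rmin r.+1; rewrite /= ec c0 mpolyC0 eqxx => /(_ isT).
  by rewrite ltnn.
pose s := c^-1 *: iter r D x.
have Ds : D s = 1 by rewrite /s linearZ /= ec -mul_mpolyC -mpolyCM mulVf.
(* Integration along the slice: if [D u] is [p(s)] and [q] is an antiderivative of [p], then
   [u - q(s)] lies in the kernel, so it is constant. *)
have inKs k u : iter k D u = 0 -> exists p, u = horner_alg s p.
  elim: k u => [|k IH] u; first by move=> /= ->; exists 0; rewrite rmorph0.
  rewrite iterSr => /IH[p ep]; have [q eq] := antiderivative p.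
  have [|b eb] := @simple_ker (u - horner_alg s q).
    rewrite linearB /= ep (@derivation_horner K D s q) ?eq ?Ds ?mulr1 ?subrr //.
    - by move=> b; apply: derivationC.
    - by move=> v w; rewrite linearD.
  by exists (q + b%:P); rewrite rmorphD /= horner_algMC -eb addrC subrK.
have [p ep] := inKs _ _ n1; have [q eq] := inKs _ _ n2.
have jr u v : jacobian u (horner_alg s v) = horner_alg s v^`() * jacobian u s.
  apply: derivation_horner; first exact: jacobianCr.
    exact: jacobianDr.
  exact: jacobianMr.
(* Two polynomials in the same [s] have vanishing Jacobian. *)
have : jacobian x y = 0.
  by rewrite ep eq jr jacobianC jr jacobianvv mulr0 oppr0 mulr0.
by rewrite jacobianXX => /eqP; rewrite oner_eq0.
Qed.

Lemma simple_not_commute_strict (l : seq (letter K)) : (0 < size l)%N ->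
  all (@strict K) l -> (forall u, D (den l u) = den l (D u)) -> False.
Proof.
move=> sl stl Dl; have [dD _] := simpleD.
have nil i : exists r, iter r D 'X_i = 0.
  have [c c0 ec] := bounded_family_dep (fun j k => orbit_partial_deg i j k dD sl stl Dl).
  exact: act_nilpotent c0 ec.
have [r1 n1] := nil ord0; have [r2 n2] := nil ord_max.
exact: simple_not_nilpotent n1 n2.
Qed.
End NotLocallyFinite.

(** * The dynamical degree *)

Section Growth.
Variable K : numClosedFieldType.
Local Notation A := {mpoly K[2]}.
Local Notation x := ('X_ord0 : A).
Local Notation y := ('X_ord_max : A).

(** Bijectivity gives only a bare function [h]; the substitution with the same values at [x] and [y]
    is a morphism and still inverts [f]. *)
Lemma lrmorph_inverse (f : {lrmorphism A -> A}) : bijective f ->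
  exists2 g : {lrmorphism A -> A}, cancel f g & cancel g f.
Proof.
move=> [h fK hK].
have gK : cancel (subst (h x) (h y)) f.
  by apply: (@lrmorph_ext _ (f \o subst (h x) (h y)) idfun); rewrite /= (substx, substy) hK.
exists (subst (h x) (h y)) => // u; apply: (can_inj fK); exact: gK.
Qed.

Lemma msize_subst_bound (h : A) C : exists C', forall f : {lrmorphism A -> A},
  (forall i, msize (f 'X_i) <= C)%N -> (msize (f h) <= C')%N.
Proof.
elim/mpoly_ring_ind: h => [c|i|u v [Cu bu] [Cv bv]|u v [Cu bu] [Cv bv]].
- by exists 1%N => f _; rewrite lrmorphC msizeC_le1.
- by exists C => f; apply.
- exists (maxn Cu Cv) => f bf; rewrite linearD (leq_trans (mmeasureD_le _ _ _)) //.
  by rewrite geq_max !leq_max bu // bv // orbT.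
- exists (Cu + Cv).+1 => f bf; rewrite rmorphM (leq_trans (msizeM_le _ _)) //.
  by rewrite ltnS leq_add ?bu ?bv.
Qed.

Lemma msize_image_bound (f : {lrmorphism A -> A}) C : exists C', forall u : A,
  (msize u <= C)%N -> (msize (f u) <= C')%N.
Proof.
exists (\max_(v : 'X_{1..2 < C}) msize (f 'X_[v])) => u su.
rewrite lrmorph_sum big_seq; elim/big_ind: _ => [|a b|v vu].
- by rewrite mmeasure0.
- by move=> la lb; rewrite (leq_trans (mmeasureD_le _ _ _)) // geq_max la.
rewrite (leq_trans (msizeZ_le _ _)) //.
have vC : (mdeg v < C)%N := leq_trans (msize_mdeg_lt vu) su.
exact: (@leq_bigmax _ (fun v : 'X_{1..2 < C} => msize (f 'X_[v])) (BMultinom vC)).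
Qed.

Lemma lrmorph_iter (f : {lrmorphism A -> A}) n :
  exists g : {lrmorphism A -> A}, g =1 iter n f.
Proof.
by elim: n => [|n [g eg]]; [exists idfun|exists (f \o g) => u; rewrite /= eg].
Qed.

(** [f^n] is [p g^n p']: iterates of bounded degree are substituted into the fixed polynomials
    [p' x] and [p' y], and then [p] is applied to polynomials of bounded degree. *)
Lemma conjugate_bounded (f : {lrmorphism A -> A}) g :
  conjugate f g -> bounded_degree g -> bounded_degree f.
Proof.
move=> [p [p' [pK p'K ef]]] [C bC].
have eg : g = p' \o f \o p by apply/funext => u; rewrite ef /= pK pK.
have [C0 b0] := msize_subst_bound (p' x) C.
have [C1 b1] := msize_subst_bound (p' y) C.
have [C2 b2] := msize_image_bound p (maxn C0 C1).
exists C2 => n i.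
have -> : iter n f 'X_i = p (iter n g (p' 'X_i)).
  by elim: n => [|n IH]; rewrite /= ?p'K // IH ef /= pK.
apply: b2; have [k ek] := lrmorph_iter (p' \o f \o p) n.
have {}ek : k =1 iter n g by move=> u; rewrite ek eg.
have bk j : (msize (k 'X_j) <= C)%N by rewrite ek.
by rewrite -ek leq_max; case: (ord2P i) => ->; rewrite ?b0 ?b1 ?orbT.
Qed.

Lemma simple_conjugate (D : {linear A -> A}) (p p' : {lrmorphism A -> A}) :
  cancel p p' -> cancel p' p -> simple_derivation D ->
  simple_derivation (p' \o D \o p : {linear A -> A}).
Proof.
move=> pK p'K [dD simp]; split.
  by move=> u v; rewrite /= rmorphM dD linearD !rmorphM /= !pK.
move=> I [I0 ID IM] DI.
have [||J0|JT] := simp [set u | I (p' u)]%classic.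
- split=> /=; first by rewrite linear0.
    by move=> u v Iu Iv; rewrite linearD; apply: ID.
  by move=> h u Iu; rewrite rmorphM; apply: IM.
- move=> _ [u /= Iu <-] /=; apply: DI; exists (p' u) => //=.
  by rewrite p'K.
- left; apply/seteqP; split=> [v Iv|v ->//].
  have : [set u | I (p' u)]%classic (p v) by rewrite /= pK.
  by rewrite J0 /= => pv0; rewrite -(pK v) pv0 linear0.
right; apply/seteqP; split=> // v _.
have : [set u | I (p' u)]%classic (p v) by rewrite JT.
by rewrite /= pK.
Qed.

Lemma isotropy_bounded_degree (D : {linear A -> A}) (f : {lrmorphism A -> A}) :
  simple_derivation D -> isotropy_group D f -> bounded_degree f.
Proof.
move=> sD [fbij comm]; have [g fK gK] := lrmorph_inverse fbij.
have [d [l [vd vl ef]]] := jung fK gK.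
have [h [bh|[m [szm stm eh]]]] := word_reduced vd vl; rewrite -ef => fh.
  exact: conjugate_bounded fh bh.
have [p [p' [pK p'K efp]]] := fh.
exfalso; apply: (simple_not_commute_strict (simple_conjugate pK p'K sD) szm stm) => u.
have emu v : den m v = p' (f (p v)) by rewrite -eh efp /= !pK.
by rewrite !emu /= !p'K; congr (p' _); exact: esym (congr1 (fun k => k (p u)) comm).
Qed.
End Growth.

(** [f^n] substitutes [f^n X_j] for [X_j], so [f^n (f X_i)] is the composition of [f X_i] with the
    [n]-th iterate of the map. *)
Lemma polymap_iterE (K : comNzRingType) (f : {lrmorphism {mpoly K[2]} -> {mpoly K[2]}}) n i :
  tnth (polymap_iter n (polymap_of f)) i = iter n f 'X_i.
Proof.
elim: n i => [|n IH] i; first by rewrite tnth_mktuple.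
rewrite /polymap_iter iterS -/(polymap_iter n _) tnth_mktuple tnth_mktuple iterSr.
have itersum (g : 'X_{1..2} -> K) (s : seq 'X_{1..2}) m :
    iter m f (\sum_(v <- s) g v *: 'X_[v]) = \sum_(v <- s) g v *: iter m f 'X_[v].
  elim: m => //= m ->; rewrite linear_sum; apply: eq_bigr => v _; exact: linearZ.
have iterprod (v : 'X_{1..2}) m :
    iter m f 'X_[v] = \prod_(j < 2) (iter m f 'X_j) ^+ v j.
  elim: m => [|m /= ->]; first by rewrite mpolyXE_id.
  by rewrite rmorph_prod; apply: eq_bigr => j _; rewrite rmorphXn.
rewrite [in RHS](mpolyE (f 'X_i)) itersum comp_mpolyEX; apply: eq_bigr => v _.
rewrite iterprod comp_mpolyX; congr (_ *: _); apply: eq_bigr => j _.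
by rewrite IH.
Qed.

Lemma cvg_powR_inv (R : realType) (B : R) :
  0 < B -> (fun n : nat => B `^ (n%:R)^-1) @ \oo --> (1 : R).
Proof.
move=> B0; rewrite -(cvg_shiftS _).
have -> : [sequence B `^ (n.+1%:R)^-1]_n = expR \o (fun n => harmonic n * ln B).
  by apply/funext => n /=; rewrite /powR gt_eqF.
have lim0 : (fun n => harmonic n * ln B) @ \oo --> (0 : R).
  by rewrite -(mul0r (ln B)); apply: cvgM; [exact: cvg_harmonic|exact: cvg_cst].
have -> : (1 : R) = expR 0 by rewrite expR0.
by apply: (cvg_comp _ _ lim0); apply: continuous_expR.
Qed.

(** Convergence is part of the conclusion because [limn] of a divergent sequence is only a default
    value. *)
Theorem corollary9 (R : realType)
    (D : {linear {mpoly R[i][2]} -> {mpoly R[i][2]}})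
    (rho : {lrmorphism {mpoly R[i][2]} -> {mpoly R[i][2]}})
    (D_simple : simple_derivation D)
    (rho_isotropy : isotropy_group D rho) :
  cvgn (dynamical_degree_seq (polymap_of rho)) /\
  dynamical_degree (polymap_of rho) = 1.
Proof.
have [C bC] := @isotropy_bounded_degree R[i] D rho D_simple rho_isotropy.
have [g rhoK _] := lrmorph_inverse rho_isotropy.1.
suff cv : dynamical_degree_seq (polymap_of rho) @ \oo --> (1 : R).
  by split; [apply: cvgP cv | apply: cvg_lim cv].
have degE n : polymap_degree (polymap_iter n (polymap_of rho)) =
    maxn (total_degree (iter n rho 'X_ord0)) (total_degree (iter n rho 'X_ord_max)).
  by rewrite /polymap_degree !polymap_iterE.
(* Injectivity keeps the iterates nonconstant, which gives the lower bound 1 for the squeeze. *)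
have deg1 n : (0 < polymap_degree (polymap_iter n (polymap_of rho)))%N.
  rewrite degE leq_max; apply/orP; left; elim: n => [|n IH].
    by rewrite /= /total_degree msizeX mdeg1.
  exact: total_deg_auto_gt0 rhoK IH.
have degC n : (polymap_degree (polymap_iter n (polymap_of rho)) <= C.+1)%N.
  by rewrite degE geq_max /total_degree !(leq_trans (leq_pred _)) // (leq_trans (bC n _)).
apply: (@squeeze_cvgr _ _ _ _ (fun=> 1) (fun n : nat => C.+1%:R `^ (n%:R)^-1)).
- apply: nearW => n; rewrite /dynamical_degree_seq.
  have d1 : (1 : R) <= (polymap_degree (polymap_iter n (polymap_of rho)))%:R.
    by rewrite ler1n.
  apply/andP; split.
    have := ler_powR d1 (_ : (0 : R) <= n%:R^-1); rewrite powRr0; apply.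
    by rewrite invr_ge0.
  by apply: ge0_ler_powR; rewrite ?invr_ge0 ?nnegrE ?ler_nat.
- exact: cvg_cst.
exact: cvg_powR_inv.
Qed.
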